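(* Let $f_\Delta=1-\sum_{m\in\partial\Delta\cap M}b_mt^m$ be the Laurent polynomial determining the hypersurface $Y''_\Delta\cap\mathbb T_N$, where $\beta=(b_m)\in\mathbb C^{l(\Delta)-1}$, and let $$\Phi_{Y''_\Delta}(\beta)=\frac{1}{(2\pi\sqrt{-1})^d}\int_\gamma\frac{1}{f_\Delta}\frac{dt_1}{t_1}\wedge\cdots\wedge\frac{dt_d}{t_d}$$ be the main period of $Y''_\Delta$, where $\gamma\subset\mathbb T_N$ is the cycle $|t_1|=\cdots=|t_d|=1$. As $Y''_\Delta$ degenerates to $Y'_\Delta$, the function $\Phi_{Y''_\Delta}(\beta)$ degenerates to the Euler integral $$\Phi_{Y'_\Delta}(\alpha)=\frac{1}{(2\pi\sqrt{-1})^d}\int_\gamma\frac{1}{g_\Delta}\frac{dt_1}{t_1}\wedge\cdots\wedge\frac{dt_d}{t_d},$$ where $g_\Delta=1-\prod_{i=0}^k\bigl(\sum_{m\in\Delta_i\cap M}a_{i,m}t^m\bigr)$ determines $Y'_\Delta\cap\mathbb T_N$ and $\alpha=(a_{i,m})\in\mathbb C^{l(\Delta_0)}\times\cdots\times\mathbb C^{l(\Delta_k)}$. One has $$\Phi_{Y'_\Delta}(\alpha)=\sum_{l\in L_{\tilde\Delta_0,\dots,\tilde\Delta_k}}\ \prod_{i=0}^k\Bigl(\sum_{m\in\Delta_i\cap M}l_{i,m}\Bigr)!\prod_{m\in\Delta_i\cap M}\frac{a_{i,m}^{l_{i,m}}}{l_{i,m}!},$$ where $L_{\tilde\Delta_0,\dots,\tilde\Delta_k}\subset\mathbb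 Z_{\ge0}^{l(\Delta_0)}\oplus\cdots\oplus\mathbb Z_{\ge0}^{l(\Delta_k)}$ is the subsemigroup of all $l=(l_{i,m})$ such that $\sum_{i=0}^k\sum_{m\in\Delta_i\cap M}l_{i,m}m=0$ and $\sum_{m\in\Delta_i\cap M}l_{i,m}=\sum_{m\in\Delta_0\cap M}l_{0,m}$ for all $i$. This is precisely the hypergeometric series of the Calabi-Yau complete intersection $Y'_{\tilde\Delta_0,\dots,\tilde\Delta_k}$ given by the Euler integral $$\Phi_{Y'_{\tilde\Delta_0,\dots,\tilde\Delta_k}}(\alpha)=\frac{1}{(2\pi\sqrt{-1})^{d+k}}\int_{\tilde\gamma}\frac{1}{f_{\tilde\Delta_0}\cdots f_{\tilde\Delta_k}}\frac{dt_1}{t_1}\wedge\cdots\wedge\frac{dt_{d+k}}{t_{d+k}},$$ where $\tilde\gamma$ is the cycle $|t_j|=1$, $j=1,\dots,d+k$, and $$f_{\tilde\Delta_0}=1-\sum_{m\in\Delta_0\cap M}a_{0,m}t^m\prod_{i=1}^kt_{d+i}^{-1},\qquad f_{\tilde\Delta_i}=1-\sum_{m\in\Delta_i\cap M}a_{i,m}t^mt_{d+i},\quad i=1,\dots,k,$$ determine the affine complete intersection $Y'_{\tilde\Delta_0,\dots,\tilde\Delta_k}\cap\mathbb T_{\tilde N}$. Therefore the main period $\Phi_{Y''_\Delta}(\beta)$ of the minimal Calabi-Yau hypersurface $Y''_\Delta$ degenerates to the main period $\Phi_{Y'_{\tilde\Delta_0,\dots,\tilde\Delta_k}}(\alpha)$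 of the minimal Calabi-Yau complete intersection $Y'_{\tilde\Delta_0,\dots,\tilde\Delta_k}$ as $Y''_\Delta$ degenerates to $Y'_\Delta$.
   Context: $M$ is a lattice of rank $d$ with dual lattice $N$. $\Delta\subset M\otimes\mathbb R$ is a reflexive polytope (a lattice polytope with $0$ in its interior whose dual $\Delta^*=\{n\in N\otimes\mathbb R\mid\langle m,n\rangle\ge-1\ \forall m\in\Delta\}$ is a lattice polytope), $\partial\Delta$ is its boundary, and $\Delta=\Delta_0+\cdots+\Delta_k$ is a Minkowski sum decomposition by lattice polytopes. $l(P)$ is the number of lattice points of a polytope $P$. An integer basis $u_1,\dots,u_d$ of $M$ is fixed, and $t_1,\dots,t_d$ are the corresponding coordinates on the torus $\mathbb T_N=\mathrm{Spec}(\mathbb C[M])$; for $m=\sum m_ju_j$, $t^m=t_1^{m_1}\cdots t_d^{m_d}$. Put $\tilde M=M\oplus\mathbb Z^k$, $\tilde N=N\oplus\mathbb Z^k$, let $e_1,\dots,e_k$ be the standard basis of $\mathbb Z^k\subset\tilde M$ and $e_0=-\sum_{i=1}^ke_i$; $t_1,\dots,t_{d+k}$ are the coordinates on $\mathbb T_{\tilde N}=\mathrm{Spec}(\mathbb C[\tilde M])$ corresponding to the basis $u_1,\dots,u_d,e_1,\dots,e_k$. Put $\tilde\Delta_i=\mathrm{Conv}(\Delta_i+e_i,0)$, $i=0,\dots,k$; then $\tilde\Delta_0+\cdots+\tilde\Delta_k$ is a reflexive polytope in $\tilde M\otimes\mathbb R$. Let $\Sigma'_{\tilde\Delta_0+\cdots+\tilde\Delta_k}$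 be a maximal projective subdivision of the normal fan of $\tilde\Delta_0+\cdots+\tilde\Delta_k$ which maps, under the projection $\tilde N\otimes\mathbb R\to N\otimes\mathbb R$, to a maximal projective subdivision $\Sigma'_\Delta$ of the normal fan of $\Delta$. $Y'_{\tilde\Delta_0,\dots,\tilde\Delta_k}$ is the generic Calabi-Yau complete intersection in the toric variety of $\Sigma'_{\tilde\Delta_0+\cdots+\tilde\Delta_k}$ given in the torus by $f_{\tilde\Delta_0}=\cdots=f_{\tilde\Delta_k}=0$. $Y'_\Delta$ is its image in the toric variety $X_{\Sigma'_\Delta}$, namely the (non-generic) Calabi-Yau hypersurface that is the closure of $\{g_\Delta=0\}$, and $Y''_\Delta$ is a nondegenerate (transversal to every torus orbit it meets) Calabi-Yau hypersurface in $X_{\Sigma'_\Delta}$ that is a smoothing of $Y'_\Delta$.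
   Formalization: The period of Y'' is divided by the constant term c of g_Delta before taking the limit (needed when c is not 1), and convergence domains are explicit: prod_i sum_m |a_{i,m}| < 1 for the series of Y', and sum_m |a_{i,m}| < 1 for each i for the complete intersection. *)

(* Defs.v *)
From HB Require Import structures.
From mathcomp Require Import all_boot all_order all_algebra finmap complex.
From mathcomp Require Import boolp classical_sets functions cardinality reals.
From mathcomp Require Import topology normedtype trigo measure lebesgue_measure.
From mathcomp Require Import lebesgue_integral summability.

Set Implicit Arguments.
Unset Strict Implicit.
Unset Printing Implicit Defensive.

Import Order.TTheory GRing.Theory Num.Theory.
Import numFieldTopology.Exports numFieldNormedType.Exports.

Local Open Scope classical_set_scope.
Local Open Scope ring_scope.

(* The fixed integer basis u_1, ..., u_d identifies M with 'rV[int]_d and N,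
   via the dual basis, with 'rV[int]_d as well. *)

Section Polytopes.
Variables (R : realType) (d : nat).
Implicit Types (P : set 'rV[R]_d) (m n : 'rV[R]_d).

Definition lattice_vec (m : 'rV[int]_d) : 'rV[R]_d := map_mx intr m.

Definition pairing m n : R := \sum_j m 0 j * n 0 j.

Definition conv_hull (s : seq 'rV[R]_d) : set 'rV[R]_d :=
  [set x | exists2 w : 'I_(size s) -> R,
     (forall i, 0 <= w i) /\ \sum_i w i = 1 & x = \sum_i w i *: s`_i].

Definition lattice_polytope P : Prop :=
  exists s : seq 'rV[int]_d, P = conv_hull (map lattice_vec s).

Definition dual_polytope P : set 'rV[R]_d :=
  [set n | forall m, P m -> - 1 <= pairing m n].

Definition reflexive_polytope P : Prop :=
  [/\ lattice_polytope P, P° 0 & lattice_polytope (dual_polytope P)].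

Definition boundary P : set 'rV[R]_d := closure P `\` P°.

Definition minkowski_sum k (P : 'I_k -> set 'rV[R]_d) : set 'rV[R]_d :=
  [set x | exists2 p : 'I_k -> 'rV[R]_d, (forall i, P i (p i)) & x = \sum_i p i].

(* [fset_set] is the expected finite set here because P is always bounded. *)
Definition lattice_points P : {fset 'rV[int]_d} :=
  fset_set [set m | P (lattice_vec m)].

(* The face of P on which n is minimal. *)
Definition face P n : set 'rV[R]_d :=
  [set m | P m /\ forall m', P m' -> pairing m n <= pairing m' n].

End Polytopes.

Section Periods.
Variable R : realType.
Local Notation C := (R[i]).

Definition expi (x : R) : C := (cos x +i* sin x)%C.

(* The integral of h(z) dz over |z| = 1, oriented counterclockwise, with
   z = exp (i x), dz = i exp (i x) dx. *)
Definition circle_integral (h : C -> C) : C :=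
  let u x := h (expi x) * ('i%C * expi x) in
  ((\int[lebesgue_measure]_(x in `[0, 2 * pi]) complex.Re (u x))
   +i* (\int[lebesgue_measure]_(x in `[0, 2 * pi]) complex.Im (u x)))%C.

(* The integral of h(t) dt_1 /\ ... /\ dt_n over |t_1| = ... = |t_n| = 1,
   as an iterated integral. *)
Fixpoint torus_integral n : ('rV[C]_n -> C) -> C :=
  match n return ('rV[C]_n -> C) -> C with
  | 0 => fun h => h 0
  | n'.+1 => fun h =>
      circle_integral (fun z =>
        torus_integral (fun t : 'rV[C]_n' => h (row_mx z%:M t)))
  end.

Definition euler_integral n (f : 'rV[C]_n -> C) : C :=
  ((2 * pi)%:C%C * 'i%C) ^- n *
  torus_integral (fun t => (f t)^-1 * \prod_j (t 0 j)^-1).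

Definition in_torus n (t : 'rV[C]_n) : Prop := forall j, t 0 j != 0.

Definition in_unit_torus n (t : 'rV[C]_n) : Prop := forall j, `|t 0 j| = 1.

Definition monomial n (t : 'rV[C]_n) (m : 'rV[int]_n) : C :=
  \prod_j t 0 j ^ m 0 j.

Section Hypersurface.
Variables (d : nat) (Delta : set 'rV[R]_d).

Definition boundary_coefs := lattice_points (boundary Delta) -> C.

Definition f_Delta (b : boundary_coefs) (t : 'rV[C]_d) : C :=
  1 - \sum_m b m * monomial t (val m).

Definition Phi_hypersurface (b : boundary_coefs) : C :=
  euler_integral (f_Delta b).

(* The part of f_Delta b supported on the face of Delta cut out by n.  In a fan
   refining the normal fan of Delta, the closure of {f_Delta b = 0} meets the
   orbit of the cone having n in its relative interior in the zero locus of
   this initial form (up to a monomial factor). *)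
Definition initial_form (b : boundary_coefs) (n : 'rV[R]_d)
    (t : 'rV[C]_d) : C :=
  (if `[< face Delta n 0 >] then 1 else 0)
  - \sum_(m | `[< face Delta n (lattice_vec R (val m)) >])
      b m * monomial t (val m).

(* t_j d/dt_j of the initial form. *)
Definition initial_form_dlog (b : boundary_coefs) (n : 'rV[R]_d) (j : 'I_d)
    (t : 'rV[C]_d) : C :=
  - \sum_(m | `[< face Delta n (lattice_vec R (val m)) >])
      (val m 0 j)%:~R * (b m * monomial t (val m)).

(* Transversality to every torus orbit.  As n runs over N, every cone of any
   rational refinement of the normal fan is reached, so the condition does not
   depend on the choice of the refinement; n = 0 is the open orbit. *)
Definition nondegenerate (b : boundary_coefs) : Prop :=
  forall (n : 'rV[int]_d) (t : 'rV[C]_d), in_torus t ->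
    initial_form b (lattice_vec R n) t = 0 ->
    exists j, initial_form_dlog b (lattice_vec R n) j t != 0.

End Hypersurface.

Section CompleteIntersection.
Variables (d k : nat) (Delta : set 'rV[R]_d).
Variable Delta_ : 'I_k.+1 -> set 'rV[R]_d.

Definition summand_coefs := forall i : 'I_k.+1, lattice_points (Delta_ i) -> C.

Implicit Type a : summand_coefs.

Definition g_Delta a (t : 'rV[C]_d) : C :=
  1 - \prod_i \sum_m a i m * monomial t (val m).

Definition Phi_degenerate a : C := euler_integral (g_Delta a).

(* [lsubmx t] is (t_1, ..., t_d) and [rsubmx t] is (t_(d+1), ..., t_(d+k));
   [unlift ord0 i] is [None] for i = 0, and [Some j] for i = j + 1, so that
   [rsubmx t 0 j] is then t_(d+i). *)
Definition f_tilde a (i : 'I_k.+1) (t : 'rV[C]_(d + k)) : C :=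
  match unlift ord0 i with
  | None => 1 - \sum_m a i m * monomial (lsubmx t) (val m)
                  * \prod_j (rsubmx t 0 j)^-1
  | Some j => 1 - \sum_m a i m * monomial (lsubmx t) (val m) * rsubmx t 0 j
  end.

Definition Phi_complete_intersection a : C :=
  euler_integral (fun t => \prod_i f_tilde a i t).

Definition exponents :=
  {dffun forall i : 'I_k.+1, {ffun lattice_points (Delta_ i) -> nat}}.

Definition in_L (l : exponents) : bool :=
  (\sum_i \sum_(m : lattice_points (Delta_ i)) val m *+ l i m == 0)
  && [forall i, (\sum_m l i m == \sum_m l ord0 m)%N].

Definition hypergeometric_term a (l : {l : exponents | in_L l}) : C :=
  \prod_i (((\sum_m val l i m)%N`!)%:R *
           \prod_m (a i m ^+ val l i m / ((val l i m)`!)%:R)).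

(* Unordered summation over the semigroup L. *)
Definition hypergeometric_series_is a (v : C) : Prop :=
  (partial_sum (hypergeometric_term a) : _ -> C^o) @ totally --> (v : C^o).

(* c * f_Delta b is an equation of the hypersurface {g_Delta a = 0}. *)
Definition same_equation (c : C) (b : boundary_coefs Delta) a : Prop :=
  c != 0 /\ forall t, in_torus t -> g_Delta a t = c * f_Delta b t.

(* The nondegenerate hypersurfaces {f_Delta (b s) = 0} tend to {g_Delta a = 0}
   along F.  The constant term of f_Delta is normalized to 1 while that of
   g_Delta a need not be; c, the constant term of g_Delta a, compares the two
   normalizations. *)
Definition degenerates_to (T : Type) (F : set_system T)
    (b : T -> boundary_coefs Delta) (c : C) a : Prop :=
  (\forall s \near F, nondegenerate (b s)) /\
  exists2 b0, same_equation c b0 a &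
    forall m, ((fun s => b s m) : T -> C^o) @ F --> (b0 m : C^o).

End CompleteIntersection.
End Periods.

(* Main.v *)
Require Import Defs.
From mathcomp Require Import all_boot all_order all_algebra finmap complex.
From mathcomp Require Import boolp classical_sets functions cardinality reals.
From mathcomp Require Import topology normedtype.
From mathcomp Require Import trigo measure lebesgue_measure lebesgue_integral.
From mathcomp Require Import constructive_ereal ereal sequences derive.
From mathcomp Require Import ftc summability.

Set Implicit Arguments.
Unset Strict Implicit.
Unset Printing Implicit Defensive.

Import Order.TTheory GRing.Theory Num.Theory.
Import numFieldTopology.Exports numFieldNormedType.Exports.

Local Open Scope classical_set_scope.
Local Open Scope ring_scope.

(* The normalized integral over |t_1| = ... = |t_n| = 1 of a Laurent polynomial
   is its constant term.  If prod_i sum_m |a_(i,m)| < 1, then 1 / g_Delta is on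
   the torus the uniform limit of the partial sums of sum_n prod_i F_i^n, where
   F_i = sum_m a_(i,m) t^m; expanding F_i^n by the multinomial theorem and taking
   constant terms keeps exactly the l in L, and the terms are dominated by
   sum_n (prod_i sum_m |a_(i,m)|)^n, so the series converges unconditionally.
   For the complete intersection one expands prod_i 1 / (1 - F_i t_(d+i)) as a
   product of k + 1 independent geometric series; the constant term in
   t_(d+1), ..., t_(d+k) then forces all the degrees |l_i| to agree, which gives
   the same series.  The degeneration statement is continuity of the mean: a
   limit f that has no zero on the compact torus is bounded below there, so the
   reciprocals converge uniformly.  Finally, 0 is the only interior lattice point
   of a reflexive polytope, so that every nonconstant monomial of g_Delta comes
   from the boundary of Delta. *)

(** * Means over the unit circle *)

Section CircleMean.
Variable R : realType.
Local Notation C := (R[i]).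
Local Notation mu := (@lebesgue_measure R).
Implicit Types (g h : C -> C) (x y : R) (z w : C).

Lemma normC_Re z : `|complex.Re z|%:C%C <= `|z|.
Proof. exact: normc_ge_Re. Qed.

Lemma normC_real x : `|x%:C%C| = `|x|%:C%C :> C.
Proof. by rewrite normc_def /= expr0n/= addr0 sqrtr_sqr. Qed.

Lemma normC_i : `|'i%C : C| = 1.
Proof. by rewrite normc_def /= expr0n/= expr1n add0r sqrtr1. Qed.

Lemma normC_Im z : `|complex.Im z|%:C%C <= `|z|.
Proof.
rewrite -[complex.Im z]opprK -ReiNIm normrN (le_trans (normc_ge_Re _))//.
by rewrite normrM normC_i mulr1.
Qed.

Lemma normC_le_ReIm z : `|z| <= (`|complex.Re z| + `|complex.Im z|)%:C%C.
Proof.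
rewrite {1}[z]complexE (le_trans (ler_normD _ _))//.
by rewrite normrM normC_i mul1r !normC_real rmorphD.
Qed.

Lemma posC_Re z : 0 < z -> 0 < complex.Re z /\ z = (complex.Re z)%:C%C.
Proof. by case: z => a b; rewrite ltcE /= => /andP[/eqP-> ->]. Qed.

Lemma norm_expi x : `|expi x| = 1.
Proof. by rewrite normc_def /= cos2Dsin2 sqrtr1. Qed.

Lemma expi_neq0 x : expi x != 0.
Proof. by rewrite -normr_eq0 norm_expi oner_eq0. Qed.

Lemma expi0 : expi (0 : R) = 1.
Proof. by rewrite /expi cos0 sin0. Qed.

Lemma expiD x y : expi (x + y) = expi x * expi y.
Proof. by rewrite /expi cosD sinD; simpc; congr (_ +i* _)%C; rewrite addrC. Qed.

Lemma expi_exprz x (m : int) : expi x ^ m = expi (m%:~R * x).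
Proof.
have hn (n : nat) : expi x ^+ n = expi (n%:R * x).
  elim: n => [|n IH]; first by rewrite mul0r expi0.
  by rewrite exprS IH -expiD [in RHS]mulrS mulrDl mul1r.
case: m => n; first exact: hn.
rewrite NegzE -exprnN hn; apply: (mulfI (expi_neq0 (n.+1%:R * x))).
by rewrite divff ?expi_neq0// mulrNz mulNr -expiD subrr expi0.
Qed.

(** The angle is plus or minus [acos] of the real part, with the sign of the imaginary part. The
    range $[-\pi,\pi]$ later serves as a compact parameter domain. *)
Lemma normC1_expi z : `|z| = 1 -> exists2 x, - pi <= x <= pi & z = expi x.
Proof.
move=> z1; have h : complex.Re z ^+ 2 + complex.Im z ^+ 2 = 1.
  by apply: complexI; rewrite add_Re2_Im2 z1 expr1n.
case: z h {z1} => a b /= h.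
have a1 : -1 <= a <= 1.
  rewrite -ler_norml -(ler_pXn2r (n := 2))// ?nnegrE//.
  by rewrite expr1n real_normK ?num_real// -h lerDl sqr_ge0.
have hs : 1 - a ^+ 2 = b ^+ 2 by rewrite -h addrC addKr.
have [b0|b0] := leP 0 b.
  exists (acos a); first by rewrite acos_lepi// andbT (le_trans _ (acos_ge0 _))// oppr_le0 pi_ge0.
  by rewrite /expi sin_acos// acosK// hs sqrtr_sqr ger0_norm.
exists (- acos a).
  by rewrite lerN2 acos_lepi//= (le_trans _ (pi_ge0 _))// oppr_le0 acos_ge0.
by rewrite /expi cosN sinN sin_acos// acosK// hs sqrtr_sqr ltr0_norm// opprK.
Qed.

Lemma expi_near x (e : C) : 0 < e -> \forall y \near x, `|expi x - expi y| < e.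
Proof.
move=> /posC_Re[e0 ->]; set r := complex.Re e in e0 *.
have r2 : 0 < r / 2 by rewrite divr_gt0.
have /cvgrPdist_lt/(_ _ r2) hc := @continuous_cos R x.
have /cvgrPdist_lt/(_ _ r2) hs := @continuous_sin R x.
near=> y; apply: (le_lt_trans (normC_le_ReIm _)); rewrite ltcR /=.
by rewrite [r]splitr ltrD//; near: y.
Unshelve. all: by end_near.
Qed.

(* Uniform continuity is asked on the circle only; outside it g is arbitrary. *)
Definition circle_uc g := forall e : C, 0 < e -> exists2 d : C, 0 < d &
  forall z w, `|z| = 1 -> `|w| = 1 -> `|z - w| < d -> `|g z - g w| <= e.

Lemma circle_uc_near g x (e : R) : circle_uc g -> 0 < e ->
  \forall y \near x, `|g (expi x) - g (expi y)| <= e%:C%C.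
Proof.
move=> gu e0; have [|d d0 hd] := gu e%:C%C; first by rewrite ltcR.
have := expi_near x d0; apply: filterS => y; apply: hd; exact: norm_expi.
Qed.

Lemma circle_uc_cvg_Re g : circle_uc g -> continuous (fun x => complex.Re (g (expi x))).
Proof.
move=> gu x; apply/cvgrPdist_le => e e0.
have := circle_uc_near x gu e0; apply: filterS => y.
by move/(le_trans (normC_Re _)); rewrite lecR raddfB.
Qed.

Lemma circle_uc_cvg_Im g : circle_uc g -> continuous (fun x => complex.Im (g (expi x))).
Proof.
move=> gu x; apply/cvgrPdist_le => e e0.
have := circle_uc_near x gu e0; apply: filterS => y.
by move/(le_trans (normC_Im _)); rewrite lecR raddfB.
Qed.

Lemma continuous_circle_integrable (f : R -> R) : continuous f ->
  mu.-integrable `[0, 2 * pi] (EFin \o f).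
Proof.
move=> cf; apply: continuous_compact_integrable; first exact: segment_compact.
exact: continuous_subspaceT.
Qed.

Lemma circle_uc_int_Re g : circle_uc g ->
  mu.-integrable `[0, 2 * pi] (EFin \o (fun x => complex.Re (g (expi x)))).
Proof. by move=> /circle_uc_cvg_Re; exact: continuous_circle_integrable. Qed.

Lemma circle_uc_int_Im g : circle_uc g ->
  mu.-integrable `[0, 2 * pi] (EFin \o (fun x => complex.Im (g (expi x)))).
Proof. by move=> /circle_uc_cvg_Im; exact: continuous_circle_integrable. Qed.

(** The mean against $dz/(2\pi i z)$, that is $dx/(2\pi)$ in the angle. *)
Definition cmean g : C :=
  ((2 * pi)^-1 * \int[mu]_(x in `[0, 2 * pi]) complex.Re (g (expi x))
   +i* ((2 * pi)^-1 * \int[mu]_(x in `[0, 2 * pi]) complex.Im (g (expi x))))%C.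

Lemma eq_cmean g h : (forall z, `|z| = 1 -> g z = h z) -> cmean g = cmean h.
Proof.
move=> gh; rewrite /cmean; congr (_ +i* _)%C; congr (_ * _);
  by apply: eq_Rintegral => x _; rewrite gh ?norm_expi.
Qed.

Lemma cmeanD g h : circle_uc g -> circle_uc h ->
  cmean (fun z => g z + h z) = cmean g + cmean h.
Proof.
move=> gu hu; rewrite /cmean; simpc; rewrite -!mulrDr.
rewrite -!RintegralD//; try exact: circle_uc_int_Re; try exact: circle_uc_int_Im.
by congr (_ +i* _)%C; congr (_ * _); apply: eq_Rintegral => x _; rewrite raddfD.
Qed.

Lemma cmeanZ c g : circle_uc g -> cmean (fun z => c * g z) = c * cmean g.
Proof.
move=> gu; have iR := circle_uc_int_Re gu; have iI := circle_uc_int_Im gu.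
have intZ (f : R -> R) a : mu.-integrable `[0, 2 * pi] (EFin \o f) ->
    mu.-integrable `[0, 2 * pi] (EFin \o (fun x => a * f x)).
  by move=> fi; apply: eq_integrable (integrableZl _ a fi).
case: c => a b; rewrite /cmean; simpc; congr (_ +i* _)%C.
- rewrite mulrCA [b * _]mulrCA -mulrBr; congr (_ * _).
  rewrite -!RintegralZl// -RintegralB//; try exact: intZ.
  by apply: eq_Rintegral => x _; case: (g _) => ? ?; simpc.
- rewrite mulrCA [b * _]mulrCA -mulrDr; congr (_ * _).
  rewrite -!RintegralZl// -RintegralD//; try exact: intZ.
  by apply: eq_Rintegral => x _; case: (g _) => ? ?; simpc.
Qed.

Lemma two_pi_gt0 : 0 < 2 * pi :> R.
Proof. by rewrite mulr_gt0// pi_gt0. Qed.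

Lemma circle_Rintegral_cst (r : R) : \int[mu]_(x in `[0, 2 * pi]) r = r * (2 * pi).
Proof.
rewrite Rintegral_cst//= lebesgue_measure_itv /= lte_fin two_pi_gt0.
by rewrite -EFinD /= subr0.
Qed.

Lemma circle_Rintegral_le (f : R -> R) (M : R) : mu.-integrable `[0, 2 * pi] (EFin \o f) ->
  (forall x, `|f x| <= M) -> `|(2 * pi)^-1 * \int[mu]_(x in `[0, 2 * pi]) f x| <= M.
Proof.
move=> fi fM; rewrite normrM ger0_norm ?invr_ge0 ?(ltW two_pi_gt0)//.
rewrite mulrC ler_pdivrMr ?two_pi_gt0// -circle_Rintegral_cst.
apply: (le_trans (le_normr_Rintegral _ fi)) => //.
apply: le_Rintegral => //.
- exact: (@integrable_norm _ _ _ mu _ _ fi).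
- by apply: continuous_circle_integrable; exact: cst_continuous.
Qed.

(* The factor 2 comes from bounding the real and imaginary parts separately. *)
Lemma cmean_le g (M : C) : circle_uc g ->
  (forall z, `|z| = 1 -> `|g z| <= M) -> `|cmean g| <= 2 * M.
Proof.
move=> gu gM.
have M0 : 0 <= M by rewrite (le_trans _ (gM 1 _))// normr1.
have hM : M = (complex.Re M)%:C%C by rewrite RRe_real// ger0_real.
apply: (le_trans (normC_le_ReIm _)); rewrite mulr_natl mulr2n hM -rmorphD lecR /=.
apply: lerD; apply: circle_Rintegral_le.
- exact: circle_uc_int_Re.
- by move=> x; rewrite -lecR -hM (le_trans (normC_Re _))// gM// norm_expi.
- exact: circle_uc_int_Im.
- by move=> x; rewrite -lecR -hM (le_trans (normC_Im _))// gM// norm_expi.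
Qed.

Lemma circle_Rintegral_FTC (f F : R -> R) : continuous f ->
  (forall x, is_derive x 1 F (f x)) -> F 0 = F (2 * pi) ->
  \int[mu]_(x in `[0, 2 * pi]) f x = 0.
Proof.
move=> cf dF F0; rewrite /Rintegral (@continuous_FTC2 _ f F)//.
- by rewrite F0 -EFinB subrr.
- exact: two_pi_gt0.
- exact: continuous_subspaceT.
- have cF : continuous F.
    by move=> x; apply/differentiable_continuous/derivable1_diffP; case: (dF x).
  split.
  + by move=> x _; case: (dF x).
  + by apply: cvg_at_right_filter; exact: cF.
  + by apply: cvg_at_left_filter; exact: cF.
- by move=> x _; rewrite derive1E; case: (dF x) => _ ->.
Qed.

Lemma cos_sin_int_2pi (m : int) :
  cos (m%:~R * (2 * pi)) = 1 :> R /\ sin (m%:~R * (2 * pi)) = 0 :> R.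
Proof.
(* Both values are read off from $(e^{2\pi i})^m = 1$. *)
have := expi_exprz (2 * pi) m.
by rewrite {1}/expi mulrC mulr_natr cos2pi sin2pi exp1rz /expi => -[<- <-].
Qed.

(** Orthogonality of the characters of the circle: for $m\ne0$ the cosine and the sine of $mx$ have
    primitives that agree at $0$ and $2\pi$. *)
Lemma cmean_exprz (m : int) : cmean (fun z => z ^ m) = (m == 0)%:R.
Proof.
have cM (f : R -> R) (a : R) : continuous f -> continuous (fun x => f (a * x)).
  move=> cf x; apply: (@continuous_comp _ _ _ (fun x => a * x) f); last exact: cf.
  by apply: cvgM; [exact: cvg_cst|exact: cvg_id].
rewrite /cmean; under eq_Rintegral do rewrite expi_exprz.
under [X in (_ +i* (_ * X))%C]eq_Rintegral do rewrite expi_exprz.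
have [->|m0] := eqVneq m 0.
  under eq_Rintegral do rewrite mul0r expi0.
  under [X in (_ +i* (_ * X))%C]eq_Rintegral do rewrite mul0r expi0.
  by rewrite /= !circle_Rintegral_cst mul0r mulr0 mul1r mulVf ?gt_eqF ?two_pi_gt0.
have mR : m%:~R != 0 :> R by rewrite intr_eq0.
have [c1 s1] := cos_sin_int_2pi m.
have iC : \int[mu]_(x in `[0, 2 * pi]) cos (m%:~R * x) = 0.
  apply: (circle_Rintegral_FTC (F := fun x => m%:~R^-1 * sin (m%:~R * x))).
  - by apply: cM; exact: continuous_cos.
  - move=> x; apply: is_derive_eq.
    by rewrite /GRing.scale /= mulr1 [cos _ * _]mulrC mulKf.
  - by rewrite mulr0 sin0 s1.
have iS : \int[mu]_(x in `[0, 2 * pi]) sin (m%:~R * x) = 0.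
  apply: (circle_Rintegral_FTC (F := fun x => - (m%:~R^-1 * cos (m%:~R * x)))).
  - by apply: cM; exact: continuous_sin.
  - move=> x; apply: is_derive_eq.
    by rewrite /GRing.scale /= mulr1 mulNr mulrN opprK [sin _ * _]mulrC mulKf.
  - by rewrite mulr0 cos0 c1.
by rewrite /expi /= iC iS !mulr0.
Qed.

(** On the circle $dz=iz\,dx$: the factor $z$ goes into the mean and $2\pi i$ comes out. *)
Lemma circle_integralE g : circle_uc (fun z => z * g z) ->
  circle_integral g = (2 * pi)%:C%C * 'i%C * cmean (fun z => z * g z).
Proof.
move=> gu; have p0 : 2 * pi != 0 :> R by rewrite gt_eqF ?two_pi_gt0.
rewrite /circle_integral /cmean -mulrA.
(* Multiplication by $i$ swaps the two parts with a sign, so the imaginary part of the mean feeds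
   the real part of the integral. *)
have -> : forall a b : R, (2 * pi)%:C%C * ('i%C * ((2 * pi)^-1 * a +i* ((2 * pi)^-1 * b))%C)
    = (- b +i* a)%C.
  by move=> a b; rewrite /GRing.mul /= !(mul0r, mulr0, mul1r, add0r, addr0, subr0, sub0r)
    mulrN !mulVKf.
congr (_ +i* _)%C.
- rewrite -mulN1r -RintegralZl//; last exact: (circle_uc_int_Im gu).
  apply: eq_Rintegral => x _; rewrite mulN1r [_ * (_ * _)]mulrCA [_ * expi x]mulrC.
  by case: (expi x * g (expi x)) => a b; simpc.
- apply: eq_Rintegral => x _; rewrite [_ * (_ * _)]mulrCA [_ * expi x]mulrC.
  by case: (expi x * g (expi x)) => a b; simpc.
Qed.

End CircleMean.

(** * Means over the torus *)

Section TorusMean.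
Variable R : realType.
Local Notation C := (R[i]).
Implicit Types (z w e : C).

(** The order of [R[i]] is partial, but positive elements are real, so the minimum is taken between
    real parts. *)
Lemma posC_min e d : 0 < e -> 0 < d -> exists c : C, [/\ 0 < c, c <= e & c <= d].
Proof.
move=> /posC_Re[e0 ->] /posC_Re[d0 ->].
exists (Num.min (complex.Re e) (complex.Re d))%:C%C.
by rewrite ltcR !lecR lt_min e0 d0 !ge_min !lexx orbT.
Qed.

Definition tcons n z (t : 'rV[C]_n) : 'rV[C]_n.+1 := row_mx z%:M t.

Lemma tcons0 n z (t : 'rV[C]_n) : tcons z t 0 ord0 = z.
Proof.
rewrite /tcons (_ : ord0 = lshift n (ord0 : 'I_1)); last exact: val_inj.
by rewrite [LHS](row_mxEl z%:M) mxE eqxx.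
Qed.

Lemma tconsS n z (t : 'rV[C]_n) j : tcons z t 0 (lift ord0 j) = t 0 j.
Proof.
rewrite /tcons (_ : lift ord0 j = rshift 1 j); last exact: val_inj.
by rewrite [LHS](row_mxEr z%:M).
Qed.

Lemma tcons_unit n z (t : 'rV[C]_n) :
  `|z| = 1 -> in_unit_torus t -> in_unit_torus (tcons z t).
Proof. by move=> z1 t1 j; case: (unliftP ord0 j) => [k|] ->; rewrite ?tconsS ?tcons0. Qed.

Lemma unit_in_torus n (t : 'rV[C]_n) : in_unit_torus t -> in_torus t.
Proof. by move=> t1 j; rewrite -normr_eq0 t1 oner_eq0. Qed.

(** The recursion of [torus_integral] with each circle integral replaced by the normalized mean. *)
Fixpoint tmean n : ('rV[C]_n -> C) -> C :=
  match n return ('rV[C]_n -> C) -> C with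
  | 0 => fun h => h 0
  | n'.+1 => fun h => cmean (fun z => tmean (fun t : 'rV[C]_n' => h (tcons z t)))
  end.

(* Uniform rather than pointwise continuity, so that the sup bound on a mean
   already shows that a partial mean is continuous in the remaining variable. *)
Definition torus_uc n (h : 'rV[C]_n -> C) :=
  (exists M : C, forall t, in_unit_torus t -> `|h t| <= M) /\
  forall e, 0 < e -> exists2 d : C, 0 < d & forall t u,
    in_unit_torus t -> in_unit_torus u ->
    (forall j, `|t 0 j - u 0 j| < d) -> `|h t - h u| <= e.

(** * Closure properties of uniform continuity on the torus, and monomials *)

Section Closure.
Variable n : nat.
Implicit Types (f g h : 'rV[C]_n -> C) (t u : 'rV[C]_n).

Lemma eq_torus_uc f g : (forall t, in_unit_torus t -> f t = g t) ->
  torus_uc f -> torus_uc g.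
Proof.
move=> fg [[M fM] fu]; split; first by exists M => t t1; rewrite -fg// fM.
move=> e /fu[d d0 hd]; exists d => // t u t1 u1 tu.
by rewrite -!fg// hd.
Qed.

Lemma torus_uc_cst c : torus_uc (fun _ : 'rV[C]_n => c).
Proof.
split; first by exists `|c|.
by move=> e e0; exists 1 => // t u _ _ _; rewrite subrr normr0 ltW.
Qed.

Lemma torus_ucD f g : torus_uc f -> torus_uc g -> torus_uc (fun t => f t + g t).
Proof.
move=> [[M fM] fu] [[N gN] gu]; split.
  by exists (M + N) => t t1; rewrite (le_trans (ler_normD _ _))// lerD ?fM ?gN.
move=> e e0; have e2 : 0 < e / 2 by rewrite divr_gt0.
have [d d0 hd] := fu _ e2; have [c c0 hc] := gu _ e2.
have [b [b0 bd bc]] := posC_min d0 c0; exists b => // t u t1 u1 tu.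
rewrite opprD addrACA (le_trans (ler_normD _ _))// [e]splitr lerD//.
- by apply: hd => // j; apply: lt_le_trans bd.
- by apply: hc => // j; apply: lt_le_trans bc.
Qed.

Lemma torus_ucM f g : torus_uc f -> torus_uc g -> torus_uc (fun t => f t * g t).
Proof.
(* The bounds become denominators below, so they are raised to be strictly positive. *)
have H f1 : torus_uc f1 -> exists2 M : C, 0 < M & forall t, in_unit_torus t -> `|f1 t| <= M.
  move=> [[M fM] _]; exists (`|M| + 1); first by rewrite ltr_wpDl.
  move=> t t1; have h := fM _ t1; have M0 : 0 <= M by exact: le_trans h.
  by rewrite (le_trans h)// ger0_norm// lerDl.
move=> fu gu; have [M M0 fM] := H _ fu; have [N N0 gN] := H _ gu.
case: fu gu => _ fu [_ gu]; split.
  by exists (M * N) => t t1; rewrite normrM ler_pM// ?fM ?gN.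
move=> e e0; have e2 : 0 < e / 2 by rewrite divr_gt0.
have [d d0 hd] := fu _ (divr_gt0 e2 N0); have [c c0 hc] := gu _ (divr_gt0 e2 M0).
have [b [b0 bd bc]] := posC_min d0 c0; exists b => // t u t1 u1 tu.
have -> : f t * g t - f u * g u = (f t - f u) * g t + f u * (g t - g u).
  by rewrite mulrBl mulrBr addrA subrK.
rewrite (le_trans (ler_normD _ _))// [e]splitr !normrM lerD//.
- rewrite -[leRHS](divfK (lt0r_neq0 N0)) ler_pM ?gN//.
  by apply: hd => // j; apply: lt_le_trans bd.
- rewrite mulrC -[leRHS](divfK (lt0r_neq0 M0)) ler_pM ?fM//.
  by apply: hc => // j; apply: lt_le_trans bc.
Qed.

Lemma torus_ucZ c f : torus_uc f -> torus_uc (fun t => c * f t).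
Proof. exact/torus_ucM/torus_uc_cst. Qed.

Lemma torus_ucB f g : torus_uc f -> torus_uc g -> torus_uc (fun t => f t - g t).
Proof.
move=> fu /(torus_ucZ (-1)) gu.
by apply: eq_torus_uc (torus_ucD fu gu) => t _; rewrite mulN1r.
Qed.

Lemma torus_uc_sum I (r : seq I) P (F : I -> 'rV[C]_n -> C) :
  (forall i, torus_uc (F i)) -> torus_uc (fun t => \sum_(i <- r | P i) F i t).
Proof.
move=> Fu; elim: r => [|i r IH].
  by apply: eq_torus_uc (torus_uc_cst 0) => t _; rewrite big_nil.
case Pi: (P i); last by apply: eq_torus_uc IH => t _; rewrite big_cons Pi.
by apply: eq_torus_uc (torus_ucD (Fu i) IH) => t _; rewrite big_cons Pi.
Qed.

Lemma torus_uc_prod I (r : seq I) P (F : I -> 'rV[C]_n -> C) :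
  (forall i, torus_uc (F i)) -> torus_uc (fun t => \prod_(i <- r | P i) F i t).
Proof.
move=> Fu; elim: r => [|i r IH].
  by apply: eq_torus_uc (torus_uc_cst 1) => t _; rewrite big_nil.
case Pi: (P i); last by apply: eq_torus_uc IH => t _; rewrite big_cons Pi.
by apply: eq_torus_uc (torus_ucM (Fu i) IH) => t _; rewrite big_cons Pi.
Qed.

Lemma torus_uc_exp f k : torus_uc f -> torus_uc (fun t => f t ^+ k).
Proof.
move=> fu; elim: k => [|k IH]; first exact: torus_uc_cst.
by apply: eq_torus_uc (torus_ucM fu IH) => t _; rewrite exprS.
Qed.

(** The difference of reciprocals is $(f(u)-f(t))/(f(t)f(u))$ with denominator at least $m^2$ in
    norm, so the modulus of [f] is taken at $em^2$. *)
Lemma torus_uc_inv f (m : C) : 0 < m -> (forall t, in_unit_torus t -> m <= `|f t|) ->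
  torus_uc f -> torus_uc (fun t => (f t)^-1).
Proof.
move=> m0 fm [_ fu]; have fn0 t : in_unit_torus t -> 0 < `|f t|.
  by move=> t1; apply: lt_le_trans m0 (fm _ t1).
split.
  by exists m^-1 => t t1; rewrite normfV lef_pV2 ?posrE ?fm ?fn0.
move=> e e0; have [|d d0 hd] := fu (e * (m * m)); first by rewrite !mulr_gt0.
exists d => // t u t1 u1 tu.
have ft := fn0 _ t1; have fu' := fn0 _ u1.
have -> : (f t)^-1 - (f u)^-1 = (f u - f t) / (f t * f u).
  by rewrite invfM mulrBl mulrCA divff -?normr_gt0// mulr1 mulrA divff -?normr_gt0// mul1r.
rewrite normrM normfV normrM ler_pdivrMr ?mulr_gt0// distrC.
apply: le_trans (hd _ _ t1 u1 tu) _.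
by rewrite ler_wpM2l ?(ltW e0)// ler_pM ?fm// ltW.
Qed.

Lemma torus_uc_coord j : torus_uc (fun t => t 0 j).
Proof.
split; first by exists 1 => t ->.
by move=> e e0; exists e => // t u _ _ tu; rewrite ltW.
Qed.

Lemma torus_uc_coordV j : torus_uc (fun t => (t 0 j)^-1).
Proof. by apply: (torus_uc_inv ltr01) (torus_uc_coord j) => t ->. Qed.

Lemma torus_uc_monomial (m : 'rV[int]_n) : torus_uc (fun t => monomial t m).
Proof.
apply: torus_uc_prod => j; case: (m 0 j) => k; first exact/torus_uc_exp/torus_uc_coord.
apply: eq_torus_uc (torus_uc_exp k.+1 (torus_uc_coordV j)) => t _.
by rewrite NegzE -exprnN exprVn.
Qed.

Lemma norm_monomial t (m : 'rV[int]_n) : in_unit_torus t -> `|monomial t m| = 1.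
Proof.
move=> t1; rewrite normr_prod big1// => j _.
by case: (m 0 j) => k; rewrite ?NegzE -?exprnN ?normfV normrX t1 expr1n ?invr1.
Qed.

Lemma monomialD t (m m' : 'rV[int]_n) : in_torus t ->
  monomial t (m + m') = monomial t m * monomial t m'.
Proof.
by move=> t0; rewrite -big_split; apply: eq_bigr => j _; rewrite mxE expfzDr.
Qed.

Lemma monomial0 t : monomial t 0 = 1.
Proof. by rewrite /monomial big1// => j _; rewrite mxE. Qed.

Lemma monomial_sum t I (r : seq I) P (F : I -> 'rV[int]_n) : in_torus t ->
  monomial t (\sum_(i <- r | P i) F i) = \prod_(i <- r | P i) monomial t (F i).
Proof.
by move=> t0; apply: (big_morph (monomial t)); [move=> ? ?; exact: monomialD|exact: monomial0].
Qed.

Lemma monomialMn t (m : 'rV[int]_n) k : in_torus t ->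
  monomial t (m *+ k) = monomial t m ^+ k.
Proof.
move=> t0; elim: k => [|k IH]; first by rewrite mulr0n monomial0.
by rewrite mulrS exprS monomialD// IH.
Qed.

End Closure.

Lemma eq_tmean n (f g : 'rV[C]_n -> C) : (forall t, in_unit_torus t -> f t = g t) ->
  tmean f = tmean g.
Proof.
elim: n f g => [|n IH] f g fg /=; first by apply: fg => -[].
by apply: eq_cmean => z z1; apply: IH => t t1; apply/fg/tcons_unit.
Qed.

Lemma torus_uc_slice n (h : 'rV[C]_n.+1 -> C) z : `|z| = 1 -> torus_uc h ->
  torus_uc (fun t => h (tcons z t)).
Proof.
move=> z1 [[M hM] hu]; split; first by exists M => t t1; apply/hM/tcons_unit.
move=> e /hu[d d0 hd]; exists d => // t u t1 u1 tu.
apply: hd; try exact: tcons_unit.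
by move=> j; case: (unliftP ord0 j) => [k|] ->; rewrite ?tconsS ?tcons0// subrr normr0.
Qed.

(** The four properties need a common induction: linearity and the sup bound in dimension $n$ make
    the partial mean uniformly continuous in the first variable, which is what the one-variable
    lemmas require in dimension $n+1$. Each variable contributes the factor 2 of [cmean_le]. *)
Lemma tmean_props n :
  [/\ forall f g : 'rV[C]_n -> C, torus_uc f -> torus_uc g ->
        tmean (fun t => f t + g t) = tmean f + tmean g,
      forall c (f : 'rV[C]_n -> C), torus_uc f -> tmean (fun t => c * f t) = c * tmean f,
      forall (f : 'rV[C]_n -> C) (M : C), torus_uc f ->
        (forall t, in_unit_torus t -> `|f t| <= M) -> `|tmean f| <= 2 ^+ n * M
    & forall h : 'rV[C]_n.+1 -> C, torus_uc h ->
        circle_uc (fun z => tmean (fun t => h (tcons z t)))].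
Proof.
have slice k : (forall f g : 'rV[C]_k -> C, torus_uc f -> torus_uc g ->
        tmean (fun t => f t + g t) = tmean f + tmean g) ->
      (forall c (f : 'rV[C]_k -> C), torus_uc f -> tmean (fun t => c * f t) = c * tmean f) ->
      (forall (f : 'rV[C]_k -> C) (M : C), torus_uc f ->
        (forall t, in_unit_torus t -> `|f t| <= M) -> `|tmean f| <= 2 ^+ k * M) ->
      forall h : 'rV[C]_k.+1 -> C, torus_uc h ->
        circle_uc (fun z => tmean (fun t => h (tcons z t))).
  move=> tD tZ tM h hu e e0; have k0 : 0 < 2 ^+ k :> C by rewrite exprn_gt0.
  (* The modulus is taken at $e/2^k$ to absorb the constant of the sup bound. *)
  have [d d0 hd] := hu.2 _ (divr_gt0 e0 k0); exists d => // z w z1 w1 zw.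
  have hz := torus_uc_slice z1 hu; have hw := torus_uc_slice w1 hu.
  rewrite -[X in _ - X]mul1r -mulNr -tZ// -tD//; last exact: torus_ucZ.
  have -> : e = 2 ^+ k * (e / 2 ^+ k) by rewrite mulrC divfK ?gt_eqF.
  apply: tM; first by apply: torus_ucD => //; exact: torus_ucZ.
  move=> t t1; rewrite mulN1r; apply: hd; try exact: tcons_unit.
  by move=> j; case: (unliftP ord0 j) => [i|] ->; rewrite ?tconsS ?tcons0// subrr normr0.
elim: n => [|n [tD tZ tM tS]].
  have tM0 (f : 'rV[C]_0 -> C) (M : C) : torus_uc f ->
      (forall t, in_unit_torus t -> `|f t| <= M) -> `|tmean f| <= 2 ^+ 0 * M.
    by move=> _ fM; rewrite expr0 mul1r; apply: fM => -[].
  by split => //; apply: slice.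
suff [tD' tZ' tM'] : [/\ forall f g : 'rV[C]_n.+1 -> C, torus_uc f -> torus_uc g ->
        tmean (fun t => f t + g t) = tmean f + tmean g,
      forall c (f : 'rV[C]_n.+1 -> C), torus_uc f -> tmean (fun t => c * f t) = c * tmean f &
      forall (f : 'rV[C]_n.+1 -> C) (M : C), torus_uc f ->
        (forall t, in_unit_torus t -> `|f t| <= M) -> `|tmean f| <= 2 ^+ n.+1 * M].
  by split => //; apply: slice.
split=> /=.
- move=> f g fu gu; rewrite -cmeanD; try exact: tS.
  by apply: eq_cmean => z z1; rewrite tD//; exact: torus_uc_slice.
- move=> c f fu; rewrite -cmeanZ; last exact: tS.
  by apply: eq_cmean => z z1; rewrite tZ//; exact: torus_uc_slice.
- move=> f M fu fM; rewrite exprS -mulrA; apply: cmean_le; first exact: tS.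
  move=> z z1; apply: tM; first exact: torus_uc_slice.
  by move=> t t1; apply/fM/tcons_unit.
Qed.

Lemma tmeanD n (f g : 'rV[C]_n -> C) : torus_uc f -> torus_uc g ->
  tmean (fun t => f t + g t) = tmean f + tmean g.
Proof. by case: (tmean_props n) => + _ _ _; apply. Qed.

Lemma tmeanZ n c (f : 'rV[C]_n -> C) : torus_uc f ->
  tmean (fun t => c * f t) = c * tmean f.
Proof. by case: (tmean_props n) => _ + _ _; apply. Qed.

Lemma tmean_le n (f : 'rV[C]_n -> C) (M : C) : torus_uc f ->
  (forall t, in_unit_torus t -> `|f t| <= M) -> `|tmean f| <= 2 ^+ n * M.
Proof. by case: (tmean_props n) => _ _ + _; apply. Qed.

Lemma tmean_slice_uc n (h : 'rV[C]_n.+1 -> C) : torus_uc h ->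
  circle_uc (fun z => tmean (fun t => h (tcons z t))).
Proof. by case: (tmean_props n) => _ _ _; apply. Qed.

Lemma tmeanB n (f g : 'rV[C]_n -> C) : torus_uc f -> torus_uc g ->
  tmean (fun t => f t - g t) = tmean f - tmean g.
Proof.
move=> fu gu; rewrite -[in RHS](mul1r (tmean g)) -mulNr -tmeanZ// -tmeanD//; last exact: torus_ucZ.
by apply: eq_tmean => t _; rewrite mulN1r.
Qed.

Lemma tmean_sum n I (r : seq I) P (F : I -> 'rV[C]_n -> C) :
  (forall i, torus_uc (F i)) ->
  tmean (fun t => \sum_(i <- r | P i) F i t) = \sum_(i <- r | P i) tmean (F i).
Proof.
move=> Fu; have tm0 : tmean (fun _ : 'rV[C]_n => 0) = 0.
  have e0 := tmeanZ 0 (torus_uc_cst n 0).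
  rewrite -[RHS](mul0r (tmean (fun _ : 'rV[C]_n => 0))) -[RHS]e0.
  by apply: eq_tmean => t _; rewrite mul0r.
elim: r => [|i r IH].
  by rewrite big_nil -tm0; apply: eq_tmean => t _; rewrite big_nil.
rewrite big_cons -IH; case Pi: (P i).
  rewrite -tmeanD//; last exact: torus_uc_sum.
  by apply: eq_tmean => t _; rewrite big_cons Pi.
by apply: eq_tmean => t _; rewrite big_cons Pi.
Qed.

(** A monomial is a product of powers of separate variables, so its iterated mean is a product of
    values given by [cmean_exprz]. *)
Lemma tmean_monomial n (m : 'rV[int]_n) : tmean (fun t => monomial t m) = (m == 0)%:R.
Proof.
elim: n m => [|n IH] m /=.
  rewrite /monomial big_ord0; suff -> : m = 0 by rewrite eqxx.
  by apply/rowP => -[].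
pose m' := \row_j m 0 (lift ord0 j).
have mE z t : monomial (tcons z t) m = z ^ m 0 ord0 * monomial t m'.
  rewrite /monomial big_ord_recl tcons0; congr (_ * _).
  by apply: eq_bigr => j _; rewrite tconsS mxE.
have -> : (m == 0) = (m 0 ord0 == 0) && (m' == 0).
  apply/eqP/andP => [mE0|[/eqP m0 /eqP m'0]].
    by rewrite mE0 mxE; split=> //; apply/eqP/rowP => j; rewrite !mxE mE0 mxE.
  apply/rowP => j; rewrite mxE; case: (unliftP ord0 j) => [k|] -> //.
  by have /rowP/(_ k) := m'0; rewrite !mxE.
rewrite (@eq_cmean _ _ (fun z => (m' == 0)%:R * z ^ m 0 ord0)); last first.
  move=> z z1; rewrite (@eq_tmean _ _ (fun t => z ^ m 0 ord0 * monomial t m')).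
    by rewrite tmeanZ ?IH 1?mulrC//; exact: torus_uc_monomial.
  by move=> t _; rewrite mE.
rewrite cmeanZ ?cmean_exprz.
  by case: (m 0 ord0 == 0); case: (m' == 0); rewrite ?(mulr0, mulr1).
(* Uniform continuity of $z\mapsto z^{m_0}$ on the circle is the one-variable case of the torus
   statement, read on 1 by 1 rows. *)
have := @torus_uc_monomial 1 (\row__ m 0 ord0).
move=> [_ hu] e /hu[d d0 hd]; exists d => // z w z1 w1 zw.
have := hd z%:M w%:M; rewrite /monomial !big_ord1 !mxE eqxx !mulr1n.
apply; try by move=> j; rewrite mxE ord1 eqxx.
by move=> j; rewrite !mxE ord1 eqxx.
Qed.

Lemma eq_circle_integral (f g : C -> C) : (forall z, `|z| = 1 -> f z = g z) ->
  circle_integral f = circle_integral g.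
Proof.
move=> fg; rewrite /circle_integral.
by congr (_ +i* _)%C; apply: eq_Rintegral => x _; rewrite fg ?norm_expi.
Qed.

Lemma eq_torus_integral n (f g : 'rV[C]_n -> C) :
  (forall t, in_unit_torus t -> f t = g t) -> torus_integral f = torus_integral g.
Proof.
elim: n f g => [|n IH] f g fg /=; first by apply: fg => -[].
by apply: eq_circle_integral => z z1; apply: IH => t t1; apply/fg/tcons_unit.
Qed.

(** The weight $\prod_j t_j^{-1}$ turns each $dt_j$ into $i\,dx_j$, so every variable contributes
    one factor $2\pi i$. *)
Lemma torus_integralE n (h : 'rV[C]_n -> C) : torus_uc h ->
  torus_integral (fun t => h t * \prod_j (t 0 j)^-1) =
  ((2 * pi)%:C%C * 'i%C) ^+ n * tmean h.
Proof.
elim: n h => [|n IH] h hu /=; first by rewrite big_ord0 mulr1 mul1r.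
set K := _ * 'i%C.
pose g z := K ^+ n * (z^-1 * tmean (fun t => h (tcons z t))).
rewrite (@eq_circle_integral _ g) => [|z z1]; last first.
  rewrite /g -tmeanZ; last exact: torus_uc_slice.
  rewrite -IH; last exact/torus_ucZ/torus_uc_slice.
  apply: eq_torus_integral => t t1; rewrite -/(tcons z t).
  have -> : \prod_j (tcons z t 0 j)^-1 = z^-1 * \prod_j (t 0 j)^-1.
    rewrite big_ord_recl tcons0; congr (_ * _).
    by apply: eq_bigr => j _; rewrite tconsS.
  by rewrite mulrA [h _ * _]mulrC.
have zg z : `|z| = 1 -> z * g z = K ^+ n * tmean (fun t => h (tcons z t)).
  move=> z1; rewrite /g mulrCA [z * _]mulrA divff ?mul1r//.
  by rewrite -normr_eq0 z1 oner_eq0.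
rewrite circle_integralE -/K; last first.
  move=> e e0; have K1 : 0 < `|K ^+ n| + 1 by rewrite ltr_wpDl.
  have [d d0 hd] := tmean_slice_uc hu (divr_gt0 e0 K1); exists d => // z w z1 w1 zw.
  rewrite !zg// -mulrBr normrM; apply: (@le_trans _ _ ((`|K ^+ n| + 1) * (e / (`|K ^+ n| + 1)))).
    by rewrite ler_pM ?hd// lerDl.
  by rewrite mulrC divfK// gt_eqF.
rewrite exprS -mulrA; congr (_ * _).
by rewrite -cmeanZ; [exact: eq_cmean|exact: tmean_slice_uc].
Qed.

Lemma euler_integralE n (f : 'rV[C]_n -> C) : torus_uc (fun t => (f t)^-1) ->
  euler_integral f = tmean (fun t => (f t)^-1).
Proof.
move=> fu; rewrite /euler_integral torus_integralE// mulKf// expf_neq0// mulf_neq0//.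
- by rewrite -[0]/(0%:C%C) (inj_eq (@complexI _)) gt_eqF// two_pi_gt0.
- by rewrite -normr_eq0 normC_i oner_eq0.
Qed.

(** In angular coordinates the torus is the image of the compact cube $[-\pi,\pi]^n$, on which the
    continuous function $|h|$ attains its minimum. *)
Lemma torus_uc_lower n (h : 'rV[C]_n -> C) : torus_uc h ->
  (forall t, in_unit_torus t -> h t != 0) ->
  exists2 m : C, 0 < m & forall t, in_unit_torus t -> m <= `|h t|.
Proof.
move=> [_ hu] h0; pose ex (x : 'rV[R]_n) : 'rV[C]_n := \row_j expi (x 0 j).
have ex1 x : in_unit_torus (ex x) by move=> j; rewrite mxE norm_expi.
pose f x : R := complex.Re `|h (ex x)|.
have fE x : (f x)%:C%C = `|h (ex x)| by rewrite /f RRe_real// normr_real.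
pose A := [set x : 'rV[R]_n | forall i, `[- pi, pi]%classic (x ord0 i)].
have cA : compact A.
  by apply: (rV_compact (A := fun=> `[- pi, pi]%classic)) => i; exact: segment_compact.
have A0 : A !=set0.
  by exists 0 => i /=; rewrite mxE in_itv /= oppr_le0 pi_ge0.
have cf : continuous f.
  move=> x; apply/(@cvgrPdist_le _ _ _ _ (nbhs_filter x)) => e e0.
  have [|d d0 hd] := hu e%:C%C; first by rewrite ltcR.
  have : nbhs x [set y : 'rV[R]_n | forall j, `|expi (x 0 j) - expi (y 0 j)| < d].
    pose near_j j := [set y : 'rV[R]_n | `|expi (x 0 j) - expi (y 0 j)| < d].
    apply: (@filter_forall _ _ near_j _ (nbhs_filter x)) => j.
    have cj : {for x, continuous (fun y : 'rV[R]_n => y 0 j)} by exact: coord_continuous.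
    exact: (cj _ (expi_near (x 0 j) d0)).
  apply: filterS => y xy; rewrite -lecR -normC_real rmorphB /= !fE.
  apply: (le_trans (ler_dist_dist _ _)); apply: hd => // j.
  by rewrite !mxE.
have [c cA' hc] := compact_EVT_min A0 cA (continuous_subspaceT cf).
exists (f c)%:C%C; first by rewrite fE normr_gt0 h0.
move=> t t1.
have /fin_all_exists[x hx] : forall j, exists x : R, (- pi <= x <= pi) /\ t 0 j = expi x.
  by move=> j; have [x ? ?] := normC1_expi (t1 j); exists x.
have -> : t = ex (\row_j x j) by apply/rowP => j; rewrite !mxE; case: (hx j).
rewrite -fE lecR hc// inE => i /=.
by rewrite mxE in_itv /=; case: (hx i).
Qed.

End TorusMean.

(** * The multinomial theorem *)

Section Multinomial.
Variable F : numFieldType.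

(** Distributivity when the type of the inner index depends on the factor: the inner sums move to a
    common tagged type, where the non-dependent law applies, and [fprod] leads back. The predicate
    [Q] is encoded by the value 0 outside it. *)
Lemma big_distr_dffun (I : finType) (T_ : I -> finType) (Q : forall i, pred (T_ i))
    (G : forall i, T_ i -> F) :
  \prod_i \sum_(j | Q i j) G i j =
  \sum_(g : {dffun forall i, T_ i} | [forall i, Q i (g i)]) \prod_i G i (g i).
Proof.
pose P_ i := [ffun j : T_ i => if Q i j then G i j else 0].
transitivity (\prod_i \sum_(x in tagged_with T_ i) untag 0 (P_ i) x).
  apply: eq_bigr => i _; rewrite -(big_tag (fun i => P_ i) i) big_mkcond.
  by apply: eq_bigr => j _; rewrite ffunE.
rewrite bigA_distr_big_dep -big_fprod (reindex _ (onW_bij _ (@fprod_of_dffun_bij _ T_))).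
rewrite [RHS]big_mkcond; apply: eq_bigr => g _ /=.
have -> : \prod_i (P_ i) (fprod_of_dffun g i) = \prod_i (if Q i (g i) then G i (g i) else 0).
  by apply: eq_bigr => i _; rewrite ffunE /fprod_of_dffun fprodE.
case: forallP => [Qg|Qg]; first by apply: eq_bigr => i _; rewrite Qg.
have [i Qi] : exists i, ~~ Q i (g i) by apply/existsP; rewrite -negb_forall; apply/forallP.
by rewrite (bigD1 i)//= (negbTE Qi) mul0r.
Qed.

(** The multinomial coefficient times $y^c$; [c] is a plain function, so bounded and unbounded
    exponents share the definition. *)
Definition multinomial_term (I : finType) (y : I -> F) (c : I -> nat) : F :=
  ((\sum_m c m)%N`!)%:R * \prod_m (y m ^+ c m / ((c m)`!)%:R).

(* l_m y^l / l! = y_m y^(l - e_m) / (l - e_m)!, and l |-> l - e_m is a bijection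
   onto the exponents of degree n; [inord] does not wrap around since n < N. *)
Lemma multinomial_shift (I : finType) (y : I -> F) N n m : (n < N)%N ->
  \sum_(l : {ffun I -> 'I_N.+1} | (\sum_j l j == n.+1)%N)
     (l m)%:R * \prod_j (y j ^+ l j / ((l j)`!)%:R) =
  y m * \sum_(l : {ffun I -> 'I_N.+1} | (\sum_j l j == n)%N)
     \prod_j (y j ^+ l j / ((l j)`!)%:R).
Proof.
move=> nN; rewrite (bigID (fun l : {ffun I -> 'I_N.+1} => 0 < l m)%N) /=.
rewrite [X in _ + X]big1 ?addr0; last first.
  by move=> l /andP[_]; rewrite -eqn0Ngt => /eqP->; rewrite mul0r.
pose inc (l : {ffun I -> 'I_N.+1}) : {ffun I -> 'I_N.+1} :=
  [ffun j => if j == m then inord (l j).+1 else l j].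
pose dec (l : {ffun I -> 'I_N.+1}) : {ffun I -> 'I_N.+1} :=
  [ffun j => if j == m then inord (l j).-1 else l j].
(* For [l m = N] the successor overflows and [inord] returns 0, so a positive value of [inc l m]
   excludes this case. *)
have inc_gt0 (l : {ffun I -> 'I_N.+1}) : (0 < inc l m)%N -> (l m < N)%N.
  rewrite ffunE eqxx /inord val_insubd.
  by case: ifP.
have incE (l : {ffun I -> 'I_N.+1}) j : (l m < N)%N ->
    inc l j = (l j + (j == m))%N :> nat.
  move=> lN; rewrite ffunE; case: eqP => [->|_]; last by rewrite addn0.
  by rewrite inordK ?addn1.
have sum_inc (l : {ffun I -> 'I_N.+1}) : (l m < N)%N ->
    (\sum_j inc l j = (\sum_j l j).+1)%N.
  move=> lN; under eq_bigr do rewrite incE//.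
  by rewrite big_split /= -[RHS]addn1; congr addn; rewrite -big_mkcond big_pred1_eq.
have le_sum (l : {ffun I -> 'I_N.+1}) : (l m <= \sum_j l j)%N.
  by rewrite (bigD1 m)//= leq_addr.
rewrite (reindex_onto inc dec) /=; last first.
  move=> l /andP[_ l0]; apply/ffunP => j; apply: val_inj; rewrite !ffunE.
  case: eqP => //= ->; have lN := ltn_ord (l m).
  have e : (inord (l m).-1 : 'I_N.+1) = (l m).-1 :> nat.
    by rewrite inordK// (leq_ltn_trans (leq_pred _)).
  by rewrite e prednK// inordK.
rewrite mulr_sumr; apply: eq_big => [l|l].
  apply/idP/idP => [/andP[/andP[s p] /eqP lE]|/eqP s].
    have lN := inc_gt0 _ p.
    by move: s; rewrite sum_inc// eqSS.
  have lN : (l m < N)%N by rewrite (leq_ltn_trans (le_sum l))// s.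
  rewrite sum_inc// s eqxx incE// eqxx addn1 /=.
  apply/eqP/ffunP => j; apply: val_inj; rewrite ffunE.
  case: eqP => [->|/eqP/negbTE jm]; last by rewrite /= incE// jm addn0.
  by rewrite incE// eqxx addn1 /= inordK.
move=> /andP[/andP[s p] /eqP lE].
have lN := inc_gt0 _ p.
rewrite (bigD1 m)//= [in RHS](bigD1 m)//= incE// eqxx addn1 mulrA [RHS]mulrA.
congr (_ * _).
  by rewrite exprS factS natrM invfM mulrCA mulVKf ?pnatr_eq0// mulrA.
by apply: eq_bigr => j /negbTE jm; rewrite incE// jm addn0.
Qed.

(** Induction on $n$ after factoring out $n!$: multiplying by $\sum_m y_m$ and shifting exponents
    weights each term by $\sum_m l_m=n+1$, the ratio of the factorials. [N] only makes the index
    type finite. *)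
Lemma multinomial (I : finType) (y : I -> F) N n : (n <= N)%N ->
  \sum_(l : {ffun I -> 'I_N.+1} | (\sum_j l j == n)%N)
     multinomial_term y (fun j => l j) = (\sum_j y j) ^+ n.
Proof.
move=> nN; transitivity (n`!%:R * \sum_(l : {ffun I -> 'I_N.+1} | (\sum_j l j == n)%N)
     \prod_j (y j ^+ l j / ((l j)`!)%:R)).
  by rewrite mulr_sumr; apply: eq_bigr => l /eqP s; rewrite /multinomial_term s.
elim: n nN => [_|n IH nN].
  rewrite mul1r (big_pred1 [ffun=> ord0]) => [|l].
    by rewrite big1// => j _; rewrite ffunE /= divr1.
  rewrite sum_nat_eq0; apply/forallP/eqP => [l0|-> j]; last by rewrite ffunE.
  by apply/ffunP => j; rewrite ffunE; apply: val_inj; exact/eqP/(implyP (l0 j)).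
rewrite exprS -IH ?(ltnW nN)// mulrCA factS mulnC natrM -mulrA; congr (_ * _).
rewrite mulr_sumr mulr_suml.
under [RHS]eq_bigr do rewrite -multinomial_shift//.
rewrite exchange_big /=; apply: eq_bigr => l /eqP s.
by rewrite -mulr_suml -s natr_sum.
Qed.

Lemma sum_multinomial (I : finType) (y : I -> F) N :
  \sum_(l : {ffun I -> 'I_N.+1} | (\sum_j l j <= N)%N)
     multinomial_term y (fun j => l j) = \sum_(n < N.+1) (\sum_j y j) ^+ n.
Proof.
rewrite (partition_big (fun l : {ffun I -> 'I_N.+1} => inord (\sum_j l j) : 'I_N.+1) predT)//=.
apply: eq_bigr => n _; rewrite -(@multinomial _ _ N); last by rewrite -ltnS.
apply: eq_bigl => l; apply/andP/eqP => [[s /eqP <-]|s]; first by rewrite inordK.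
by rewrite s -ltnS ltn_ord; split=> //; apply/eqP/val_inj; rewrite /= inordK.
Qed.

End Multinomial.

(** * Unconditional summation *)

Section UnorderedSum.
Variables (R : realType) (X : choiceType).
Local Notation C := (R[i]).
Implicit Types (A B : {fset X}).

Lemma big_fset_subset (V : nmodType) (g : X -> V) A B : fsubset A B ->
  \sum_(x <- B) g x = \sum_(x <- A) g x + \sum_(x <- B | x \notin A) g x.
Proof.
move=> AB; rewrite (bigID (mem A))/=; congr (_ + _); rewrite -big_filter.
apply: perm_big; apply: uniq_perm; rewrite ?filter_uniq ?fset_uniq// => x.
by rewrite mem_filter; apply/andP/idP => [[]//|xA]; split=> //; exact: (fsubsetP AB).
Qed.

(** Bounded absolute sums along an exhaustion have small tails: past some [J N], any further finite
    set of terms contributes at most $e/2$, while the sum over [J N] is already within $e/2$ of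
    [v]. *)
Lemma partial_sum_totally (f : X -> C) (J : nat -> {fset X}) (B v : C) :
  (forall N M, (N <= M)%N -> fsubset (J N) (J M)) ->
  (forall x, exists N, x \in J N) ->
  (forall N, \sum_(x <- J N) `|f x| <= B) ->
  (forall e : C, 0 < e -> exists N0, forall N, (N0 <= N)%N ->
     `|v - \sum_(x <- J N) f x| <= e) ->
  (partial_sum f : _ -> C^o) @ totally --> (v : C^o).
Proof.
move=> Jmono Jex fB Jv.
(* The absolute sums are moved to [R], where the supremum exists. *)
pose W N : R := complex.Re (\sum_(x <- J N) `|f x|).
have WE N : (W N)%:C%C = \sum_(x <- J N) `|f x|.
  by rewrite /W RRe_real// ger0_real// sumr_ge0.
have supW : has_sup (range W).
  split; first by exists (W 0%N); exists 0%N.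
  exists (complex.Re B) => _ [N _ <-].
  have := fB N; rewrite -WE lecE /= => /andP[_]; exact.
have Jfin A : exists N, fsubset A (J N).
  have [N hN] : exists N : A -> nat, forall x, val x \in J (N x).
    by apply: (fin_all_exists (P := fun x n => val x \in J n)) => x; exact: Jex.
  exists (\max_x N x)%N; apply/fsubsetP => x xA.
  by apply: (fsubsetP (Jmono _ _ (leq_bigmax [` xA]%fset))); exact: hN [` xA]%fset.
apply/(@cvgrPdist_le _ _ _ _ totally_filter) => e e0; have e2 : 0 < e / 2 by rewrite divr_gt0.
have [N0 hN0] := Jv _ e2.
have [r0 rE] := posC_Re e2; set r := complex.Re (e / 2) in r0 rE.
have [_ [N1 _ <-] hN1] := sup_adherent r0 supW.
pose N := maxn N0 N1.
have WN M : W M - W N <= r.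
  rewrite lerBlDr; apply: (@le_trans _ _ (sup (range W))).
    by apply: ub_le_sup; [case: supW|exists M].
  rewrite addrC -lerBlDr ltW// (lt_le_trans hN1)//.
  rewrite -lecR !WE (big_fset_subset _ (Jmono N1 N (leq_maxr _ _))) lerDl.
  by rewrite sumr_ge0.
exists (J N) => // A /= NA.
have -> : partial_sum f A = \sum_(x <- A) f x by rewrite /partial_sum big_seq_fsetE.
(* Enclosing [A] in some [J M] bounds the terms outside [J N] by [W M - W N]. *)
have [M AM] := Jfin A; have NM : fsubset (J N) (J M) by apply: fsubset_trans NA AM.
rewrite (big_fset_subset _ NA) opprD addrA (le_trans (ler_normB _ _))// [e]splitr.
apply: lerD; first by apply: hN0; exact: leq_maxl.
apply: (le_trans (ler_norm_sum _ _ _)); rewrite rE.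
apply: (@le_trans _ _ ((W M - W N)%:C%C)); last by rewrite lecR.
rewrite rmorphB /= !WE (big_fset_subset _ NM) addrC addKr.
rewrite [leLHS]big_mkcond [leRHS]big_mkcond (big_fset_subset _ AM) lerDl.
by rewrite sumr_ge0// => x _; case: ifP.
Qed.

Lemma big_pmap_insub (V : nmodType) (P : pred X) (g : X -> V) (s : seq X) :
  \sum_(x <- pmap (insub : X -> option {x | P x}) s) g (val x) = \sum_(x <- s | P x) g x.
Proof.
elim: s => [|x s IH]; first by rewrite !big_nil.
rewrite big_cons /=; case: insubP => [u Pu uE|/negbTE->] /=; last exact: IH.
by rewrite Pu big_cons IH uE.
Qed.

End UnorderedSum.

(** * Constant terms of expansions indexed by several exponent vectors *)

Section MultinomialSeries.
Variables (R : realType) (n k : nat).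
Local Notation C := (R[i]).
Variable I_ : 'I_k.+1 -> finType.
Variables (x : forall i, I_ i -> 'rV[int]_n) (a : forall i, I_ i -> C).
Arguments x : clear implicits.
Arguments a : clear implicits.

Notation exps := {dffun forall i : 'I_k.+1, {ffun I_ i -> nat}}.
(* [box N] is a finite type containing all exponents of degrees at most N. *)
Notation box N := {dffun forall i : 'I_k.+1, {ffun I_ i -> 'I_N.+1}}.

Definition box_exps N (b : box N) : exps := [ffun i => [ffun m => b i m : nat]].

Definition exps_term (l : exps) : C := \prod_i multinomial_term (a i) (l i).

Definition exps_weight (l : exps) : 'rV[int]_n := \sum_i \sum_m x i m *+ l i m.

Definition exps_le N (l : exps) := [forall i, (\sum_m l i m <= N)%N].

Lemma box_expsE N (b : box N) i m : box_exps b i m = b i m.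
Proof. by rewrite !ffunE. Qed.

Lemma box_exps_inj N : injective (@box_exps N).
Proof.
move=> b c bc; apply/ffunP => i; apply/ffunP => m; apply: val_inj.
by rewrite /= -!box_expsE bc.
Qed.

Lemma exps_le_box N l : exps_le N l -> exists b : box N, l = box_exps b.
Proof.
move=> /forallP lN; exists [ffun i => [ffun m => inord (l i m)]].
apply/ffunP => i; apply/ffunP => m; rewrite box_expsE !ffunE inordK//.
by rewrite ltnS (leq_trans _ (lN i))// (bigD1 m)//= leq_addr.
Qed.

(** Absorbing the monomial into the variables, $a_{i,m}$ becoming $a_{i,m}t^{x_{i,m}}$, puts the
    expansion in reach of the multinomial theorem. *)
Lemma exps_term_monomial l t : in_torus t ->
  exps_term l * monomial t (exps_weight l) =
  \prod_i multinomial_term (fun m => a i m * monomial t (x i m)) (l i).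
Proof.
move=> t0; rewrite /exps_weight monomial_sum// -big_split; apply: eq_bigr => i _ /=.
rewrite monomial_sum// /multinomial_term -mulrA -big_split; congr (_ * _).
by apply: eq_bigr => m _ /=; rewrite monomialMn// exprMn mulrAC.
Qed.

Lemma norm_exps_term l : `|exps_term l| = \prod_i multinomial_term (fun m => `|a i m|) (l i).
Proof.
rewrite normr_prod; apply: eq_bigr => i _; rewrite normrM normr_nat normr_prod; congr (_ * _).
by apply: eq_bigr => m _; rewrite normrM normrX normfV normr_nat.
Qed.

(** [Q] selects the exponents that occur in the expansion of [H], and [L] those among them of weight
    0. The mean of a truncated expansion is its sum over [L], and uniform approximation of [H]
    passes to means. *)
Lemma multinomial_series_cvg (Q L : pred exps) (H : 'rV[C]_n -> C) (B : C) :
  torus_uc H -> (forall l, L l = Q l && (exps_weight l == 0)) ->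
  (forall N, \sum_(b : box N | Q (box_exps b) && exps_le N (box_exps b))
     `|exps_term (box_exps b)| <= B) ->
  (forall e : C, 0 < e -> exists N0, forall N, (N0 <= N)%N ->
     forall t, in_unit_torus t ->
     `|H t - \sum_(b : box N | Q (box_exps b) && exps_le N (box_exps b))
         exps_term (box_exps b) * monomial t (exps_weight (box_exps b))| <= e) ->
  (partial_sum (fun l : {l | L l} => exps_term (val l)) : _ -> C^o) @ totally
     --> (tmean H : C^o).
Proof.
move=> Hu LQ HB Hlim.
(* [J N] below consists of the elements of [L] all of whose degrees are at most [N]; it is
   enumerated through the finite type [box N]. *)
pose s N := map (@box_exps N) [seq b <- enum {: box N} | exps_le N (box_exps b)].
have us N : uniq (s N).
  by rewrite (map_inj_uniq (@box_exps_inj N)) filter_uniq// enum_uniq.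
have ins N l : (l \in s N) = exps_le N l.
  apply/mapP/idP => [[b + ->]|lN]; first by rewrite mem_filter => /andP[].
  by have [b lb] := exps_le_box lN; exists b => //; rewrite mem_filter -lb lN mem_enum.
pose p N := pmap (insub : exps -> option {l | L l}) (s N).
have up N : uniq (p N) by exact: pmap_sub_uniq.
pose J N := [fset l in p N]%fset.
have inJ N l : (l \in J N) = exps_le N (val l).
  by rewrite !inE /= mem_pmap_sub ins.
have sumJ (V : nmodType) (g : exps -> V) N : \sum_(l <- J N) g (val l) =
    \sum_(b : box N | L (box_exps b) && exps_le N (box_exps b)) g (box_exps b).
  rewrite (perm_big (p N)) /=; last first.
    by apply: uniq_perm; rewrite ?fset_uniq// => l; rewrite !inE.
  rewrite big_pmap_insub big_map big_filter_cond big_enum_cond.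
  by apply: eq_bigl => b; rewrite inE /= andbC.
apply: (@partial_sum_totally _ _ _ J B).
- move=> N M NM; apply/fsubsetP => l; rewrite !inJ => /forallP lN.
  by apply/forallP => i; exact: leq_trans (lN i) NM.
- move=> l; exists (\max_i \sum_m val l i m)%N; rewrite inJ; apply/forallP => i.
  exact: (leq_bigmax (F := fun i => \sum_m val l i m)%N).
- move=> N; rewrite (sumJ _ (fun l => `|exps_term l|)); apply: le_trans (HB N).
  rewrite [leRHS](bigID (fun b => L (box_exps b)))/= -[leLHS]addr0 lerD ?sumr_ge0//.
  rewrite le_eqVlt; apply/orP; left; apply/eqP; apply: eq_bigl => b.
  by rewrite LQ; case: (Q _); case: (exps_le _ _); case: (_ == _).
- move=> e e0; have n0 : 0 < 2 ^+ n :> C by rewrite exprn_gt0.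
  have [N0 hN0] := Hlim _ (divr_gt0 e0 n0); exists N0 => N /hN0 {}hN0.
  rewrite sumJ.
  pose G t := \sum_(b : box N | Q (box_exps b) && exps_le N (box_exps b))
      exps_term (box_exps b) * monomial t (exps_weight (box_exps b)).
  have Gu : torus_uc G by apply: torus_uc_sum => b; exact/torus_ucZ/torus_uc_monomial.
  have -> : \sum_(b : box N | L (box_exps b) && exps_le N (box_exps b)) exps_term (box_exps b)
      = tmean G.
    rewrite tmean_sum => [|b]; last exact/torus_ucZ/torus_uc_monomial.
    rewrite big_mkcond [RHS]big_mkcond; apply: eq_bigr => b _.
    rewrite tmeanZ; last exact: torus_uc_monomial.
    rewrite tmean_monomial LQ; case: (Q _) => //=.
    case: (exps_le _ _); rewrite ?andbF ?andbT//.
    by case: (_ == _); rewrite ?mulr1 ?mulr0.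
  rewrite -tmeanB//.
  have -> : e = 2 ^+ n * (e / 2 ^+ n) by rewrite mulrC divfK// gt_eqF.
  by apply: tmean_le => //; exact: torus_ucB.
Qed.

(** The degrees vary independently, so the sum factors over $i$ into truncated geometric series. *)
Lemma exps_le_sum N (y : forall i, I_ i -> C) :
  \sum_(b : box N | exps_le N (box_exps b)) \prod_i multinomial_term (y i) (box_exps b i) =
  \prod_i \sum_(j < N.+1) (\sum_m y i m) ^+ j.
Proof.
under [RHS]eq_bigr do rewrite -sum_multinomial.
rewrite big_distr_dffun; apply: eq_big => [b|b _].
  by apply: eq_forallb => i; under eq_bigr do rewrite box_expsE.
by apply: eq_bigr => i _; congr multinomial_term; apply: funext => m; rewrite box_expsE.
Qed.

Definition exps_balanced (l : exps) := [forall i, (\sum_m l i m == \sum_m l ord0 m)%N].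

(** Grouping by the common degree $j$ gives the product over $i$ of $j$-th powers, hence a single
    truncated geometric series. *)
Lemma exps_balanced_sum N (y : forall i, I_ i -> C) :
  \sum_(b : box N | exps_balanced (box_exps b) && exps_le N (box_exps b))
     \prod_i multinomial_term (y i) (box_exps b i) =
  \sum_(j < N.+1) (\prod_i \sum_m y i m) ^+ j.
Proof.
rewrite (partition_big (fun b : box N => inord (\sum_m b ord0 m) : 'I_N.+1) predT)//=.
apply: eq_bigr => j _; rewrite -prodrXl.
have jN : (j <= N)%N by rewrite -ltnS.
under [RHS]eq_bigr do rewrite -(multinomial _ jN).
rewrite big_distr_dffun; apply: eq_big => [b|b _]; last first.
  by apply: eq_bigr => i _; congr multinomial_term; apply: funext => m; rewrite box_expsE.
have sE i : (\sum_m box_exps b i m = \sum_m b i m)%N.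
  by apply: eq_bigr => m _; rewrite box_expsE.
apply/andP/forallP => [[/andP[/forallP bb /forallP bN] /eqP bj] i|bj].
  have := bb i; have := bN ord0; rewrite !sE => b0 /eqP->.
  by rewrite -bj inordK.
split; last by rewrite (eqP (bj ord0)); apply/eqP/val_inj; rewrite /= inordK.
apply/andP; split; apply/forallP => i; rewrite !sE (eqP (bj i))//.
by rewrite (eqP (bj ord0)).
Qed.

End MultinomialSeries.

(** * Lattice points of reflexive polytopes *)

Section LatticePolytopes.
Variables (R : realType) (d : nat).
Implicit Types (P : set 'rV[R]_d) (x n : 'rV[R]_d) (m : 'rV[int]_d).

Lemma lattice_polytope_bounded P : lattice_polytope P ->
  exists2 K : R, 0 <= K & forall x, P x -> forall j, `|x 0 j| <= K.
Proof.
case=> s ->; set s' := map _ s.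
pose K := \sum_(i < size s') \sum_j `|s'`_i 0 j|.
have K0 : 0 <= K by rewrite sumr_ge0// => i _; rewrite sumr_ge0.
exists K => // x [w [w0 w1] ->] j; rewrite summxE.
apply: (le_trans (ler_norm_sum _ _ _)).
apply: (@le_trans _ _ (\sum_i w i * K)); last by rewrite -mulr_suml w1 mul1r.
apply: ler_sum => i _; rewrite mxE normrM ger0_norm// ler_wpM2l//.
rewrite /K (bigD1 i)//= (bigD1 j)//= -addrA lerDl addr_ge0// sumr_ge0// => *.
by rewrite sumr_ge0.
Qed.

Lemma pairingZl (c : R) x n : pairing (c *: x) n = c * pairing x n.
Proof. by rewrite /pairing mulr_sumr; apply: eq_bigr => j _; rewrite mxE mulrA. Qed.

Lemma pairingZr (c : R) x n : pairing x (c *: n) = c * pairing x n.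
Proof. by rewrite /pairing mulr_sumr; apply: eq_bigr => j _; rewrite mxE mulrCA. Qed.

Lemma pairing_sumr x (I : finType) (w : I -> R) (y : I -> 'rV[R]_d) :
  pairing x (\sum_i w i *: y i) = \sum_i w i * pairing x (y i).
Proof.
under [RHS]eq_bigr do rewrite mulr_sumr.
rewrite exchange_big; apply: eq_bigr => j _ /=; rewrite summxE mulr_sumr.
by apply: eq_bigr => i _; rewrite mxE mulrCA.
Qed.

Lemma conv_hull_nth (s : seq 'rV[R]_d) (i : 'I_(size s)) : conv_hull s s`_i.
Proof.
exists (fun j => (j == i)%:R); first split=> [j|]; first exact: ler0n.
  by rewrite -natr_sum -big_mkcond big_pred1_eq.
rewrite (bigD1 i)//= eqxx scale1r big1 ?addr0// => j /negbTE->.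
by rewrite scale0r.
Qed.

Lemma pairing_lattice m m' :
  pairing (lattice_vec R m) (lattice_vec R m') = (\sum_j m 0 j * m' 0 j)%:~R.
Proof. by rewrite rmorph_sum; apply: eq_bigr => j _; rewrite !mxE rmorphM. Qed.

Lemma reflexive_interior_lattice P m : reflexive_polytope P ->
  P° (lattice_vec R m) -> m = 0.
Proof.
move=> [lP _ lD] im; have [K K0 hK] := lattice_polytope_bounded lP.
have Pm : P (lattice_vec R m) by exact: interior_subset im.
set x := lattice_vec R m in im Pm.
(* A dilation of m stays in P, so the integers <m, n> for the lattice points n
   generating the dual exceed -1; the resulting <m, n> >= 0 on the whole dual is
   then tested on a small negative multiple of m. *)
have K1 : 0 < K + 1 by rewrite ltr_wpDl.
(* [K] bounds the coordinates of [x], so a relative dilation by [e / (K + 1)] moves [x] by less than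
   the radius [e] of a ball contained in [P]. *)
have [e e0 he] : exists2 e : R, 0 < e & P ((1 + e) *: x).
  move: im => /nbhs_ballP[e /= e0 he]; exists (e / (K + 1)); first by rewrite divr_gt0.
  apply: he; split=> // i j; rewrite ord1 /ball /=.
  have -> : ((1 + e / (K + 1)) *: x) 0 j = (1 + e / (K + 1)) * x 0 j by rewrite mxE.
  rewrite mulrDl mul1r opprD addrA subrr sub0r normrN.
  rewrite normrM ger0_norm ?divr_ge0 ?ltW// -mulrA gtr_pMr// mulrC ltr_pdivrMr// mul1r.
  by rewrite (le_lt_trans (hK _ Pm j))// ltrDl.
have e1 : 0 < 1 + e by rewrite ltr_wpDl.
have dual_gt n : dual_polytope P n -> - 1 < pairing x n.
  move=> /(_ _ he); rewrite pairingZl -ler_pdivrMl// => h; apply: lt_le_trans h.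
  by rewrite mulrN1 ltrN2 invf_lt1// ltrDl.
have dual_ge0 n : dual_polytope P n -> 0 <= pairing x n.
  case: lD => s sE; rewrite sE => -[w [w0 _] ->]; rewrite pairing_sumr.
  apply: sumr_ge0 => i _; rewrite mulr_ge0//.
  have /dual_gt : dual_polytope P (map (@lattice_vec R d) s)`_i.
    by rewrite sE; exact: conv_hull_nth.
  rewrite (nth_map 0); last by rewrite -(size_map (@lattice_vec R d)).
  rewrite pairing_lattice -[-1]/((-1)%:~R) ltr_int ler0z => h.
  by rewrite -lezD1 addNr in h.
(* For $y\in P$ one has $\langle y,x\rangle\le dK^2\le q$, so $-x/q$ lies in the dual; the added 1
   keeps [q] positive. *)
pose q := d%:R * (K * K) + 1.
have q0 : 0 < q by rewrite ltr_wpDl// mulr_ge0// mulr_ge0.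
have : 0 <= pairing x (- q^-1 *: x).
  apply: dual_ge0 => y Py; rewrite pairingZr mulNr lerN2.
  rewrite mulrC ler_pdivrMr// mul1r.
  apply: (@le_trans _ _ (\sum_(j < d) K * K)).
    apply: ler_sum => j _; apply: (le_trans (ler_norm _)); rewrite normrM.
    by rewrite ler_pM ?hK.
  by rewrite sumr_const card_ord -mulr_natl lerDl.
rewrite pairingZr mulNr oppr_ge0 pmulr_rle0 ?invr_gt0// => h.
have s0 : pairing x x = 0.
  by apply: le_anti; rewrite h /= sumr_ge0// => j _; rewrite -expr2 sqr_ge0.
apply/rowP => j; rewrite mxE; apply/eqP.
have /eqP := s0; rewrite psumr_eq0 => [/allP/(_ j (mem_index_enum _))|i _].
  by rewrite /= mulf_eq0 orbb mxE intr_eq0.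
by rewrite -expr2 sqr_ge0.
Qed.

Lemma bounded_lattice_finite P (K : R) :
  (forall x, P x -> forall j, `|x 0 j| <= K) ->
  finite_set [set m | P (lattice_vec R m)].
Proof.
move=> PK; pose B := Num.Def.archi_bound `|K|.
(* Integers in $[-B,B]$ are the elements of ['I_(B + B).+1] shifted by $-B$. *)
pose f (v : 'rV['I_(B + B).+1]_d) : 'rV[int]_d := \row_j ((v 0 j)%:Z - B%:Z).
apply: (@sub_finite_set _ _ (range f)); last first.
  by apply: finite_image; exact: finite_finset.
move=> m /= Pm; have mB j : `|m 0 j| <= B%:Z.
  have := PK _ Pm j; rewrite mxE -intr_norm => h.
  have h' : K < B%:R by rewrite (le_lt_trans (ler_norm _))// archi_boundP.
  by rewrite -(ler_int R) (le_trans h)// ltW.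
exists (\row_j inord (absz (m 0 j + B%:Z))) => //.
apply/rowP => j; rewrite !mxE; have := mB j; rewrite ler_norml => /andP[l u].
have p : 0 <= m 0 j + B%:Z by rewrite -lerBlDr sub0r.
rewrite inordK; first by rewrite gez0_abs// addrK.
by rewrite ltnS -lez_nat gez0_abs// PoszD lerD2r.
Qed.

Lemma lattice_boundary_finite P : lattice_polytope P ->
  finite_set [set m | boundary P (lattice_vec R m)].
Proof.
move=> /lattice_polytope_bounded[K K0 hK].
(* [boundary] lies in the closure, each point of which is within distance 1 of [P]; hence
   [K + 1]. *)
apply: (@bounded_lattice_finite _ (K + 1)) => x [cx _] j.
have [y [Py xy]] := cx _ (nbhsx_ballx x 1 ltr01).
have := xy.2 0 j; rewrite /ball /= => xyj.
rewrite -[x 0 j](subrK (y 0 j)) (le_trans (ler_normD _ _))// addrC lerD ?hK//.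
exact: ltW.
Qed.

Lemma lattice_pointsP P (m : lattice_points P) : P (lattice_vec R (val m)).
Proof.
suff h v : v \in lattice_points P -> P (lattice_vec R v) by exact/h/valP.
(* In the infinite case [fset_set] is empty and the claim is vacuous. *)
have [fP|iP] := pselect (finite_set [set m | P (lattice_vec R m)]).
  by rewrite in_fset_set// inE.
by rewrite /lattice_points /fset_set; case: pselect.
Qed.

Lemma reflexive_boundary_lattice P m : reflexive_polytope P -> P (lattice_vec R m) ->
  m != 0 -> m \in lattice_points (boundary P).
Proof.
move=> rP Pm m0; rewrite in_fset_set; last by apply: lattice_boundary_finite; case: rP.
rewrite inE; split; first exact: subset_closure.
by move=> /(reflexive_interior_lattice rP)/eqP; exact/negP.
Qed.

Lemma reflexive_boundary_neq0 P (m : lattice_points (boundary P)) :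
  reflexive_polytope P -> val m != 0.
Proof.
move=> [_ P0 _]; have [_ ni] := lattice_pointsP m; apply/eqP => m0; apply: ni.
rewrite m0; suff -> : lattice_vec R 0 = 0 :> 'rV_d by [].
by apply/rowP => j; rewrite !mxE.
Qed.

End LatticePolytopes.

(** * Periods *)

Section Geometric.
Variable R : realType.
Local Notation C := (R[i]).
Implicit Types (z r e c : C).

Lemma norm_1B_ge z r : `|z| <= r -> 1 - r <= `|1 - z|.
Proof.
by move=> zr; rewrite (le_trans _ (lerB_normD _ _))// normrN normr1 lerD2l lerN2.
Qed.

Lemma geometric_rest z N : z != 1 ->
  (1 - z)^-1 - \sum_(j < N) z ^+ j = z ^+ N / (1 - z).
Proof.
move=> z1; have z0 : 1 - z != 0 by rewrite subr_eq0 eq_sym.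
apply: (mulfI z0); rewrite mulrBr divff// mulrCA divff// mulr1.
by rewrite -[1 - z]opprB mulNr -subrX1 opprK addrC subrK.
Qed.

Lemma geometric_dist z r N : `|z| <= r -> r < 1 ->
  `|(1 - z)^-1 - \sum_(j < N) z ^+ j| <= r ^+ N / (1 - r).
Proof.
move=> zr r1; have r0 : 0 < 1 - r by rewrite subr_gt0.
have zB := norm_1B_ge zr; have z0 := lt_le_trans r0 zB.
rewrite geometric_rest; last by rewrite eq_sym -subr_eq0 -normr_gt0.
rewrite normrM normfV normrX ler_pM// ?invr_ge0//.
  by rewrite lerXn2r// ?nnegrE// (le_trans _ zr).
by rewrite lef_pV2.
Qed.

Lemma geometric_le r N : 0 <= r -> r < 1 -> \sum_(j < N) r ^+ j <= (1 - r)^-1.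
Proof.
move=> r0 r1; rewrite -subr_ge0 geometric_rest ?lt_eqF//.
by rewrite divr_ge0 ?exprn_ge0// subr_ge0 ltW.
Qed.

Lemma geometric_small r c e : 0 <= r -> r < 1 -> 0 <= c -> 0 < e ->
  exists N0, forall N, (N0 <= N)%N -> c * r ^+ N <= e.
Proof.
move=> r0 r1 c0 e0; have c1 : 0 < c + 1 by rewrite ltr_wpDl.
have [d0 dE] := posC_Re (divr_gt0 e0 c1); set d := complex.Re _ in d0 dE.
have rE : r = (complex.Re r)%:C%C by rewrite RRe_real// ger0_real.
have s0 : 0 <= complex.Re r by rewrite -lecR -rE.
have s1 : complex.Re r < 1 by rewrite -ltcR -rE.
have : `|complex.Re r| < 1 by rewrite ger0_norm.
move=> /cvg_expr/cvgrPdist_le/(_ _ d0)[N0 _ hN0]; exists N0 => N /hN0.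
rewrite /= sub0r normrN ger0_norm ?exprn_ge0// => h.
apply: (@le_trans _ _ ((c + 1) * r ^+ N)); first by rewrite ler_wpM2r ?exprn_ge0// lerDl.
by rewrite mulrC -ler_pdivlMr// dE rE -rmorphXn lecR.
Qed.

(** Telescoping: the factors are exchanged one at a time, each exchange costing at most [e] times a
    power of [K]; since $1\le K$, all these powers are at most [K ^+ size s]. *)
Lemma prod_dist (I : Type) (s : seq I) (u v : I -> C) (K e : C) : 1 <= K ->
  (forall i, `|u i| <= K) -> (forall i, `|v i| <= K) -> (forall i, `|u i - v i| <= e) ->
  `|\prod_(i <- s) u i - \prod_(i <- s) v i| <= (size s)%:R * K ^+ size s * e.
Proof.
move=> K1 uK vK uv; have K0 : 0 <= K by exact: le_trans K1.
have prodK (w : I -> C) s' : (forall i, `|w i| <= K) -> `|\prod_(i <- s') w i| <= K ^+ size s'.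
  move=> wK; elim: s' => [|i s' IH]; first by rewrite big_nil normr1.
  by rewrite big_cons exprS normrM ler_pM.
elim: s => [|i s IH]; first by rewrite !big_nil subrr normr0 mul0r mul0r.
have e0 : 0 <= e by rewrite (le_trans _ (uv i)).
rewrite !big_cons; set U := \prod_(j <- s) u j; set V := \prod_(j <- s) v j.
have -> : u i * U - v i * V = (u i - v i) * U + v i * (U - V).
  by rewrite mulrBl mulrBr addrA subrK.
rewrite (le_trans (ler_normD _ _))// !normrM /= -natr1 [_ + 1]addrC !mulrDl mul1r lerD//.
  rewrite mulrC ler_pM//; apply: (le_trans (prodK _ _ uK)).
  by rewrite exprS ler_peMl// exprn_ge0.
rewrite exprS [_%:R * _]mulrCA -[leRHS]mulrA ler_pM//.
Qed.

(** The maximum is taken over real parts, where the order is total; its default value 0 yields $0\le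
    r$. *)
Lemma ltr1_common (I : finType) (A : I -> C) : (forall i, 0 <= A i) ->
  (forall i, A i < 1) -> exists r, [/\ 0 <= r, r < 1 & forall i, A i <= r].
Proof.
move=> A0 A1; have AE i : A i = (complex.Re (A i))%:C%C by rewrite RRe_real// ger0_real.
exists (\big[Num.max/0]_i complex.Re (A i))%:C%C; split.
- by rewrite ler0c; exact: bigmax_ge_id.
- by rewrite -[1]/(1%:C%C) ltcR; apply: bigmax_lt => // i _; rewrite -ltcR -AE.
- by move=> i; rewrite AE lecR; exact: le_bigmax.
Qed.

End Geometric.

(** * Degeneration of the main period and the two hypergeometric expansions *)

Section Periods.
Variables (R : realType) (d k : nat).
Local Notation C := (R[i]).
Variables (Delta : set 'rV[R]_d) (Delta_ : 'I_k.+1 -> set 'rV[R]_d).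
Implicit Type a : summand_coefs Delta_.

Lemma norm_laurent_le n (I : finType) (c : I -> C) (x : I -> 'rV[int]_n) t :
  in_unit_torus t -> `|\sum_m c m * monomial t (x m)| <= \sum_m `|c m|.
Proof.
move=> t1; apply: (le_trans (ler_norm_sum _ _ _)); apply: ler_sum => m _.
by rewrite normrM norm_monomial// mulr1.
Qed.

Lemma torus_uc_laurent n (I : finType) (c : I -> C) (x : I -> 'rV[int]_n) :
  torus_uc (fun t => \sum_m c m * monomial t (x m)).
Proof. by apply: torus_uc_sum => m; exact/torus_ucZ/torus_uc_monomial. Qed.

Lemma torus_uc_f_Delta (b : boundary_coefs Delta) : torus_uc (f_Delta b).
Proof. by apply: torus_ucB; [exact: torus_uc_cst|exact: torus_uc_laurent]. Qed.

(** On the torus $g_\Delta=c\,f_{b_0}$, so the limit period is the mean of $1/f_{b_0}$ divided by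
    $c$. Convergence of the finitely many coefficients is uniform convergence of $f$ on the torus,
    and a lower bound [mu] for $|f_{b_0}|$ transfers it to reciprocals. *)
Lemma Phi_hypersurface_cvg a (T : Type) (F : set_system T) (FF : ProperFilter F)
    (b : T -> boundary_coefs Delta) (c : C) :
  (forall t, in_unit_torus t -> g_Delta a t != 0) -> degenerates_to F b c a ->
  ((fun s => Phi_hypersurface (b s) / c) : T -> C^o) @ F --> (Phi_degenerate a : C^o).
Proof.
move=> g0 [_ [b0 [c0 gE] bF]].
have gE1 t : in_unit_torus t -> g_Delta a t = c * f_Delta b0 t.
  by move=> t1; exact/gE/unit_in_torus.
have f0 t : in_unit_torus t -> f_Delta b0 t != 0.
  by move=> t1; have := g0 _ t1; rewrite gE1// mulf_eq0 negb_or => /andP[].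
have [mu mu0 hmu] := torus_uc_lower (torus_uc_f_Delta b0) f0.
have f0u := torus_uc_inv mu0 hmu (torus_uc_f_Delta b0).
have -> : Phi_degenerate a = tmean (fun t => (f_Delta b0 t)^-1) / c.
  have gV t : in_unit_torus t -> c^-1 * (f_Delta b0 t)^-1 = (g_Delta a t)^-1.
    by move=> t1; rewrite gE1// invfM.
  rewrite /Phi_degenerate euler_integralE; last exact: eq_torus_uc gV (torus_ucZ _ f0u).
  by rewrite -(eq_tmean gV) tmeanZ// mulrC.
apply/cvgrPdist_le => e e0.
have c1 : 0 < `|c| by rewrite normr_gt0.
have n0 : 0 < 2 ^+ d :> C by rewrite exprn_gt0.
have m2 : 0 < mu / 2 by rewrite divr_gt0.
have mm : 0 < mu * (mu / 2) by rewrite mulr_gt0.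
have e1 : 0 < e * `|c| / 2 ^+ d by rewrite divr_gt0// mulr_gt0.
(* The bound $\mu/2$ on [del] keeps the nearby $|f|$ above $\mu/2$; the other makes reciprocals
   differ by at most $e|c|/2^d$, which offsets the factor $2^d$ of [tmean_le] and the division by
   [c]. *)
have [del [del0 del1 del2]] := posC_min m2 (mulr_gt0 e1 mm).
(* One more than the number of coefficients: errors [del / q] in each add up to at most [del], and
   [q] is positive. *)
pose q : C := #|{: lattice_points (boundary Delta)}|%:R + 1.
have q0 : 0 < q by rewrite ltr_wpDl.
have : \forall s \near F, forall m, `|b0 m - b s m| <= del / q.
  apply: filter_forall => m.
  by have /cvgrPdist_le/(_ _ (divr_gt0 del0 q0)) := bF m.
apply: filterS => s hs.
have fd t : in_unit_torus t -> `|f_Delta (b s) t - f_Delta b0 t| <= del.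
  move=> t1; rewrite /f_Delta opprB addrC addrA subrK -sumrB.
  under eq_bigr do rewrite -mulrBl.
  apply: (le_trans (norm_laurent_le (fun m => b0 m - b s m) _ t1)).
  apply: (@le_trans _ _ (\sum_(m : lattice_points (boundary Delta)) del / q)).
    by apply: ler_sum => m _; exact: hs.
  rewrite sumr_const -mulr_natl mulrCA -[leRHS]mulr1 ler_wpM2l ?(ltW del0)//.
  by rewrite ler_pdivrMr// mul1r lerDl.
have fs t : in_unit_torus t -> mu / 2 <= `|f_Delta (b s) t|.
  move=> t1; rewrite -(lerD2r del) (@le_trans _ _ mu)//.
    by rewrite [leRHS]splitr lerD2l.
  rewrite (le_trans (hmu _ t1))// -[X in `|X| <= _](subrK (f_Delta (b s) t)).
  by rewrite addrC (le_trans (ler_normD _ _))// lerD2l distrC fd.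
have fsu := torus_uc_inv m2 fs (torus_uc_f_Delta (b s)).
rewrite /Phi_hypersurface euler_integralE// -mulrBl normrM normfV ler_pdivrMr//.
rewrite -tmeanB//.
have -> : e * `|c| = 2 ^+ d * (e * `|c| / 2 ^+ d) by rewrite [RHS]mulrC divfK// gt_eqF.
apply: tmean_le => [|t t1]; first exact: torus_ucB.
have ft0 := f0 _ t1; have fst0 : f_Delta (b s) t != 0.
  by rewrite -normr_gt0 (lt_le_trans m2)// fs.
have -> : (f_Delta b0 t)^-1 - (f_Delta (b s) t)^-1 =
    (f_Delta (b s) t - f_Delta b0 t) / (f_Delta b0 t * f_Delta (b s) t).
  by rewrite invfM mulrBl mulrCA divff// mulr1 mulrA divff// mul1r.
rewrite normrM normfV normrM ler_pdivrMr ?mulr_gt0 ?normr_gt0//.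
rewrite (le_trans (fd _ t1))// (le_trans del2)// ler_wpM2l ?(ltW e1)//.
by rewrite ler_pM ?hmu ?fs// ltW.
Qed.

(** The coefficient contributed by choosing one lattice point in each [Delta_ i] when the product in
    [g_Delta] is expanded. *)
Definition choice_coef a (g : {dffun forall i, lattice_points (Delta_ i)}) : C :=
  \prod_i a i (g i).

Lemma g_Delta_expand a t : in_torus t -> g_Delta a t =
  1 - \sum_(g : {dffun forall i, lattice_points (Delta_ i)})
        choice_coef a g * monomial t (\sum_i val (g i)).
Proof.
move=> t0; congr (1 - _); rewrite (big_distr_dffun (fun _ => xpredT)).
apply: eq_big => [g|g _]; first by apply/forallP.
by rewrite monomial_sum// -big_split.
Qed.

Lemma choice_sum_in_Delta (Delta_sum : Delta = minkowski_sum Delta_)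
    (g : {dffun forall i, lattice_points (Delta_ i)}) :
  Delta (lattice_vec R (\sum_i val (g i))).
Proof.
rewrite Delta_sum; exists (fun i => lattice_vec R (val (g i))).
  by move=> i; exact: lattice_pointsP.
by rewrite /lattice_vec; exact: (raddf_sum (map_mx intr)).
Qed.

(** Choices of total exponent 0 form the constant term [c], which is nonzero because their sum is
    smaller than 1 in norm. All other exponents are nonzero lattice points of [Delta], hence
    boundary points. *)
Lemma same_equation_exists a : reflexive_polytope Delta ->
  Delta = minkowski_sum Delta_ -> \prod_i \sum_m `|a i m| < 1 ->
  exists (c : C) (b0 : boundary_coefs Delta), same_equation c b0 a.
Proof.
move=> rD sD A1.
pose w (g : {dffun forall i, lattice_points (Delta_ i)}) := \sum_i val (g i).
pose c := 1 - \sum_(g | w g == 0) choice_coef a g.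
have c0 : c != 0.
  rewrite subr_eq0 eq_sym; apply/eqP => c1.
  suff : `|\sum_(g | w g == 0) choice_coef a g| < 1 by rewrite c1 normr1 ltxx.
  apply: le_lt_trans A1.
  apply: (le_trans (ler_norm_sum _ _ _)).
  rewrite (big_distr_dffun (fun _ => xpredT)).
  rewrite [leRHS](eq_bigl xpredT) => [|g]; last exact/forallP.
  rewrite [leRHS](bigID (fun g => w g == 0))/= -[leLHS]addr0 lerD//.
    by apply: ler_sum => g _; rewrite normr_prod.
  by rewrite sumr_ge0// => g _; rewrite prodr_ge0.
exists c, (fun m => (\sum_(g | w g == val m) choice_coef a g) / c); split=> // t t0.
rewrite g_Delta_expand// /f_Delta mulrBr mulr1 mulr_sumr.
rewrite (bigID (fun g => w g == 0)) /= opprD addrA; congr (_ - _).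
  congr (1 - _); apply: eq_bigr => g /eqP w0.
  by rewrite -/(w g) w0 monomial0 mulr1.
(* After exchanging sums, a choice of nonzero total exponent is counted at exactly one boundary
   point, and one of exponent 0 at none. *)
under [RHS]eq_bigr do rewrite mulrA [c * _]mulrC divfK// mulr_suml big_mkcond /=.
rewrite exchange_big /= [LHS]big_mkcond; apply: eq_bigr => g _.
have [w0|w0] := eqVneq (w g) 0.
  rewrite /= big1// => m _; rewrite w0 eq_sym.
  by have /negbTE := reflexive_boundary_neq0 m rD => /= ->.
have wb := reflexive_boundary_lattice rD (choice_sum_in_Delta sD g) w0.
by rewrite -big_mkcond (big_pred1 [` wb]%fset).
Qed.

Lemma norm_prod_laurent_le a t : in_unit_torus t ->
  `|\prod_i \sum_m a i m * monomial t (val m)| <= \prod_i \sum_m `|a i m|.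
Proof.
by move=> t1; rewrite normr_prod ler_prod// => i _; rewrite normr_ge0 norm_laurent_le.
Qed.

Lemma hypergeometric_degenerate a : \prod_i \sum_m `|a i m| < 1 ->
  hypergeometric_series_is a (Phi_degenerate a).
Proof.
set r := \prod_i _ => r1.
have r0 : 0 <= r by rewrite prodr_ge0// => i _; rewrite sumr_ge0.
have Br : 0 < 1 - r by rewrite subr_gt0.
have gu : torus_uc (fun t => (g_Delta a t)^-1).
  apply: (torus_uc_inv Br).
    by move=> t t1; exact/norm_1B_ge/norm_prod_laurent_le.
  apply: torus_ucB; first exact: torus_uc_cst.
  by apply: torus_uc_prod => i; exact: torus_uc_laurent.
rewrite /Phi_degenerate euler_integralE//.
apply: (@multinomial_series_cvg R d k (fun i => lattice_points (Delta_ i))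
  (fun i m => val m) a (@exps_balanced k _) (@in_L _ _ _ Delta_) _ (1 - r)^-1) => //.
- by move=> l; rewrite /in_L andbC.
- move=> N; under eq_bigr do rewrite norm_exps_term.
  by rewrite (exps_balanced_sum N (fun i m => `|a i m|)); exact: geometric_le.
- move=> e e0.
  have [|N0 hN0] := geometric_small r0 r1 _ e0 (c := (1 - r)^-1).
    by rewrite invr_ge0 ltW.
  exists N0 => N NN t t1.
  under eq_bigr do rewrite (exps_term_monomial _ _ _ (unit_in_torus t1)).
  rewrite (exps_balanced_sum N (fun i m => a i m * monomial t (val m))).
  (* Degrees 0 to [N] give [N.+1] terms, so the remainder carries $r^{N+1}$. *)
  apply: (le_trans (geometric_dist _ (norm_prod_laurent_le a t1) r1)).
  by rewrite mulrC hN0// (leq_trans NN).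
Qed.

(* t^m t_(d+i) is the monomial of this exponent, where t_(d+0) stands for
   (t_(d+1) ... t_(d+k))^-1. *)
Definition tilde_exponent (i : 'I_k.+1) (m : lattice_points (Delta_ i)) : 'rV[int]_(d + k) :=
  row_mx (val m) (\row_j if unlift ord0 i is Some j' then (j == j')%:R else -1).

Lemma f_tildeE a i t :
  f_tilde a i t = 1 - \sum_m a i m * monomial t (tilde_exponent m).
Proof.
have mE (m : lattice_points (Delta_ i)) : monomial t (tilde_exponent m) =
    monomial (lsubmx t) (val m) *
    \prod_j rsubmx t 0 j ^ (if unlift ord0 i is Some j' then (j == j')%:R else -1).
  rewrite /monomial big_split_ord; congr (_ * _); apply: eq_bigr => j _.
    by rewrite row_mxEl mxE.
  by rewrite row_mxEr !mxE.
rewrite /f_tilde; case: unlift mE => [j|] mE; congr (1 - _); apply: eq_bigr => m _.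
  rewrite mE mulrA (bigD1 j)//= eqxx big1 ?mulr1// => j' /negbTE->.
  by [].
by rewrite mE mulrA; congr (_ * _); apply: eq_bigr => j _; rewrite exprN1.
Qed.

(** The first $d$ coordinates of the weight express the relation in $M$. Its last coordinates are
    the differences $|l_i|-|l_0|$ for $i\ge1$, owing to the exponents $-1$ at $i=0$, so they vanish
    exactly when all degrees agree. *)
Lemma in_L_tilde (l : exponents Delta_) :
  in_L l = (exps_weight tilde_exponent l == 0).
Proof.
rewrite /exps_weight; set W := \sum_i _.
have lW : lsubmx W = \sum_i \sum_(m : lattice_points (Delta_ i)) val m *+ l i m.
  rewrite raddf_sum; apply: eq_bigr => i _; rewrite raddf_sum; apply: eq_bigr => m _.
  by rewrite raddfMn /= row_mxKl.
have rW j : rsubmx W 0 j =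
    (\sum_m l (lift ord0 j) m)%N%:Z - (\sum_m l ord0 m)%N%:Z.
  have vE i : (rsubmx (\sum_m tilde_exponent m *+ l i m)) 0 j =
      (if unlift ord0 i is Some j' then (j == j')%:R else -1) * (\sum_m l i m)%N%:Z.
    rewrite -[X in _ * X]natz natr_sum mulr_sumr raddf_sum summxE; apply: eq_bigr => m _.
    by rewrite raddfMn /= row_mxKr mulmxnE mxE mulr_natr.
  rewrite raddf_sum summxE (bigD1 ord0)//= vE unlift_none mulN1r addrC; congr (_ - _).
  rewrite (bigD1 (lift ord0 j))//= vE liftK eqxx mul1r [X in _ + X]big1 ?addr0// => i /andP[i0 ij].
  rewrite vE; case: unliftP i0 ij => [j' ->|-> //] _.
  by rewrite (inj_eq lift_inj) eq_sym => /negbTE->; rewrite mul0r.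
rewrite /in_L -lW; apply/andP/eqP => [[/eqP l0 /forallP b]|W0].
  rewrite -[W]hsubmxK l0 (_ : rsubmx W = 0) ?row_mx0//.
  by apply/rowP => j; rewrite rW (eqP (b _)) subrr mxE.
split; first by rewrite W0 raddf0.
apply/forallP => i; case: (unliftP ord0 i) => [j|] -> //.
by have := rW j; rewrite W0 raddf0 mxE => /esym/eqP; rewrite subr_eq0 eqz_nat.
Qed.

(** A common bound $r<1$ makes all $k+1$ geometric series converge uniformly on the torus, and
    [prod_dist] carries this to their product. *)
Lemma hypergeometric_complete_intersection a : (forall i, \sum_m `|a i m| < 1) ->
  hypergeometric_series_is a (Phi_complete_intersection a).
Proof.
move=> A1; have A0 i : 0 <= \sum_m `|a i m| by rewrite sumr_ge0.
have [r [r0 r1 Ar]] := ltr1_common A0 A1.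
have Br : 0 < 1 - r by rewrite subr_gt0.
have fV t : in_unit_torus t ->
    \prod_i (f_tilde a i t)^-1 = (\prod_i f_tilde a i t)^-1.
  by move=> _; rewrite prodfV.
have fB i t : in_unit_torus t -> 1 - r <= `|f_tilde a i t|.
  move=> t1; rewrite f_tildeE; apply: norm_1B_ge.
  by rewrite (le_trans (norm_laurent_le _ _ t1)).
have fu : torus_uc (fun t => (\prod_i f_tilde a i t)^-1).
  apply: eq_torus_uc fV _; apply: torus_uc_prod => i.
  apply: (torus_uc_inv Br) => [t t1|]; first exact: fB.
  apply: (eq_torus_uc (f := fun t => 1 - \sum_m a i m * monomial t (tilde_exponent m))).
    by move=> t _; rewrite f_tildeE.
  by apply: torus_ucB; [exact: torus_uc_cst|exact: torus_uc_laurent].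
rewrite /Phi_complete_intersection euler_integralE//.
apply: (@multinomial_series_cvg R (d + k) k (fun i => lattice_points (Delta_ i))
  (fun i m => tilde_exponent m) a xpredT (@in_L _ _ _ Delta_) _
  (\prod_(i < k.+1) (1 - r)^-1)) => //.
- by move=> l; rewrite in_L_tilde.
- move=> N; under eq_bigr do rewrite norm_exps_term.
  rewrite (exps_le_sum N (fun i m => `|a i m|)); apply: ler_prod => i _.
  rewrite sumr_ge0 => [|j _]; last by rewrite exprn_ge0.
  rewrite (le_trans _ (geometric_le N.+1 r0 r1))//; apply: ler_sum => j _.
  by rewrite lerXn2r// nnegrE.
- move=> e e0; set K := (1 - r)^-1.
  have K0 : 0 <= K by rewrite invr_ge0 ltW.
  have K1 : 1 <= K by rewrite invf_ge1// gerBl.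
  pose s := index_enum 'I_k.+1.
  (* This constant is the one of [prod_dist] times the factor $K=1/(1-r)$ of each geometric
     remainder. *)
  have [|N0 hN0] := geometric_small r0 r1 _ e0 (c := (size s)%:R * K ^+ size s * K).
    by rewrite !mulr_ge0// exprn_ge0.
  exists N0 => N NN t t1.
  under [X in _ - X]eq_bigr do rewrite (exps_term_monomial _ _ _ (unit_in_torus t1)).
  rewrite (exps_le_sum N (fun i m => a i m * monomial t (tilde_exponent m))) -fV//.
  apply: (@le_trans _ _ ((size s)%:R * K ^+ size s * (r ^+ N.+1 * K))); last first.
    by rewrite [r ^+ _ * _]mulrC mulrA hN0// (leq_trans NN).
  have Fr i : `|\sum_m a i m * monomial t (tilde_exponent m)| <= r.
    by rewrite (le_trans (norm_laurent_le _ _ t1)).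
  apply: prod_dist => // i.
  + by rewrite normfV lef_pV2 ?posrE ?fB// (lt_le_trans Br)// fB.
  + apply: (le_trans (ler_norm_sum _ _ _)); apply: le_trans (geometric_le N.+1 r0 r1).
    by apply: ler_sum => j _; rewrite normrX lerXn2r// nnegrE.
  + by rewrite f_tildeE; exact: geometric_dist.
Qed.

End Periods.

Theorem mainTheorem5 (R : realType) (d k : nat) (Delta : set 'rV[R]_d)
    (Delta_ : 'I_k.+1 -> set 'rV[R]_d)
    (Delta_reflexive : reflexive_polytope Delta)
    (Delta_lattice : forall i, lattice_polytope (Delta_ i))
    (Delta_sum : Delta = minkowski_sum Delta_) :
  [/\ (forall a : summand_coefs Delta_,
         (forall t, in_unit_torus t -> g_Delta a t != 0) ->
         forall (T : Type) (F : set_system T) (FF : ProperFilter F)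
           (b : T -> boundary_coefs Delta) (c : R[i]),
         degenerates_to F b c a ->
         ((fun s => Phi_hypersurface (b s) / c) : T -> R[i]^o) @ F
           --> (Phi_degenerate a : R[i]^o)),
      (forall a : summand_coefs Delta_, \prod_i \sum_m `|a i m| < 1 ->
         (exists (c : R[i]) (b0 : boundary_coefs Delta), same_equation c b0 a)
         /\ hypergeometric_series_is a (Phi_degenerate a))
    & (forall a : summand_coefs Delta_, (forall i, \sum_m `|a i m| < 1) ->
         hypergeometric_series_is a (Phi_complete_intersection a) /\
         forall (T : Type) (F : set_system T) (FF : ProperFilter F)
           (b : T -> boundary_coefs Delta) (c : R[i]),
         degenerates_to F b c a ->
         ((fun s => Phi_hypersurface (b s) / c) : T -> R[i]^o) @ F
           --> (Phi_complete_intersection a : R[i]^o))].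
Proof.
split=> a.
- by move=> g0 T F FF b c; exact: Phi_hypersurface_cvg.
- by move=> A1; split; [exact: same_equation_exists|exact: hypergeometric_degenerate].
- move=> A1; have hCI := hypergeometric_complete_intersection A1; split=> // T F FF b c bF.
  (* The factor at [ord0] is smaller than 1 and the others are at most 1. *)
  have r1 : \prod_i \sum_m `|a i m| < 1.
    rewrite (bigD1 ord0)//= (le_lt_trans _ (A1 ord0))// ler_piMr ?sumr_ge0//.
    by apply: prodr_ile1 => i _; rewrite sumr_ge0//= (ltW (A1 i)).
  (* Both periods are limits of the same unordered series, so they coincide by uniqueness of
     limits. *)
  have <- : Phi_degenerate a = Phi_complete_intersection a.
    exact: (norm_cvg_unique (FF := fmap_proper_filter _ totally_filter)
              (hypergeometric_degenerate r1) hCI).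
  apply: Phi_hypersurface_cvg => // t t1; rewrite -normr_gt0.
  have := norm_1B_ge (norm_prod_laurent_le a t1); apply: lt_le_trans.
  by rewrite subr_gt0.
Qed.
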